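(* Consider a discounted constrained MDP satisfying the Slater condition with constant $\xi>0$. Fix a state distribution $\rho$ and a state-action distribution $\nu_0$. Let $\{(\theta^{(t)},\lambda^{(t)})\}_{t=0}^{T-1}$ be generated by the approximate NPG-PD algorithm with log-linear policies (see context), with $\|\phi_{s,a}\|\le B$ and $\eta_1=\eta_2=1/\sqrt T$. Assume that the estimation and transfer errors satisfy $\mathcal E_{\diamond,\mathrm{est}}^{(t)}\le\epsilon_{\mathrm{est}}$ and $\mathcal E_{\diamond,\mathrm{bias}}^{(t)}\le\epsilon_{\mathrm{bias}}$ for all $t\ge0$ and $\diamond\in\{r,g\}$, and that the relative condition number $\kappa$ is finite. Then $$\mathbb E\Big[\frac1T\sum_{t=0}^{T-1}\big(V_r^\star(\rho)-V_r^{(t)}(\rho)\big)\Big]\le\frac{C_3}{(1-\gamma)^5}\frac1{\sqrt T}+\frac{2+4/\xi}{(1-\gamma)^2}\Big(\sqrt{|A|\epsilon_{\mathrm{bias}}}+\sqrt{\frac{\kappa|A|\epsilon_{\mathrm{est}}}{1-\gamma}}\Big),$$ $$\mathbb E\Big(\Big[\frac1T\sum_{t=0}^{T-1}\big(b-V_g^{(t)}(\rho)\big)\Big]_+\Big)\le\frac{C_4}{(1-\gamma)^4}\frac1{\sqrt T}+\frac{4+2\xi}{1-\gamma}\Big(\sqrt{|A|\epsilon_{\mathrm{bias}}}+\sqrt{\frac{\kappa|A|\epsilon_{\mathrm{est}}}{1-\gamma}}\Big),$$ where $C_3=1+\log|A|+5B^2W^2/\xi^2$ and $C_4=(1+\l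og|A|+B^2W^2)\xi+(2+4B^2W^2)/\xi$.
   Context: Constrained MDP: $S$, $A$ finite state and action spaces; $P(s'\mid s,a)$ transition probabilities; $r,g:S\times A\to[0,1]$ reward and utility; $\gamma\in[0,1)$; $b\in(0,1/(1-\gamma)]$; $\rho\in\Delta_S$ initial state distribution ($\Delta_X$ is the set of probability distributions on $X$). A policy is $\pi:S\to\Delta_A$; $\Pi$ is the set of all policies. For $\diamond\in\{r,g\}$: $V_\diamond^\pi(s)=\mathbb E[\sum_{t\ge0}\gamma^t\diamond(s_t,a_t)\mid\pi,s_0=s]$, $Q_\diamond^\pi(s,a)=\mathbb E[\sum_{t\ge0}\gamma^t\diamond(s_t,a_t)\mid\pi,s_0=s,a_0=a]$, $V_\diamond^\pi(\rho)=\mathbb E_{s\sim\rho}[V_\diamond^\pi(s)]$. Problem: maximize $V_r^\pi(\rho)$ over $\pi\in\Pi$ subject to $V_g^\pi(\rho)\ge b$; $\pi^\star$ is an optimal solution, $V_\diamond^\star(\rho)=V_\diamond^{\pi^\star}(\rho)$. Slater condition with constant $\xi>0$: some $\bar\pi\in\Pi$ has $V_g^{\bar\pi}(\rho)-b\ge\xi$. $[x]_+=\max(x,0)$. Visitation distributions: $d_\rho^\pi(s)=(1-\gamma)\mathbb E_{s_0\sim\rho}\sum_{t\ge0}\gamma^tP^\pi(s_t=s\mid s_0)$ and $\nu_{\nu_0}^\pi(s,a)=(1-\gamma)\mathbb E_{(s_0,a_0)\sim\nu_0}\sum_{t\ge0}\gamma^tP^\pi(s_t=s,a_t=a\mid s_0,a_0)$.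 Log-linear policies: for features $\phi_{s,a}\in\mathbb R^d$ and $\theta\in\mathbb R^d$, $\pi_\theta(a\mid s)=\exp(\theta^\top\phi_{s,a})/\sum_{a'}\exp(\theta^\top\phi_{s,a'})$. Superscript $(t)$ means evaluated at $\pi^{(t)}=\pi_{\theta^{(t)}}$; $\nu^{(t)}=\nu_{\nu_0}^{\pi^{(t)}}$. Regression error: $\mathcal E_\diamond^\nu(w;\theta)=\mathbb E_{(s,a)\sim\nu}[(Q_\diamond^{\pi_\theta}(s,a)-w^\top\phi_{s,a})^2]$. Fix $W>0$. Algorithm: at each $t$, (possibly random) vectors $w_r^{(t)},w_g^{(t)}$ with $\|w_\diamond^{(t)}\|_2\le W$ are computed as approximate minimizers of $\mathcal E_\diamond^{\nu^{(t)}}(w;\theta^{(t)})$ over $\|w\|_2\le W$; with $w^{(t)}=w_r^{(t)}+\lambda^{(t)}w_g^{(t)}$ and $\mathcal P_\Lambda$ the projection onto $\Lambda=[0,2/((1-\gamma)\xi)]$, $$\theta^{(t+1)}=\theta^{(t)}+\frac{\eta_1}{1-\gamma}w^{(t)},\qquad\lambda^{(t+1)}=\mathcal P_\Lambda\big(\lambda^{(t)}-\eta_2(V_g^{(t)}(\rho)-b)\big).$$ Errors: let $w_{\diamond,\star}^{(t)}\in\arg\min_{\|w\|_2\le W}\mathcal E_\diamond^{\nu^{(t)}}(w;\theta^{(t)})$ be an exact minimizer and $\nu^\star(s,a)=d_\rho^{\pi^\star}(s)\cdot\frac1{|A|}$. Estimation error: $\mathcal E_{\diamond,\mathrm{est}}^{(t)}=\mathbb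 E[\mathcal E_\diamond^{\nu^{(t)}}(w_\diamond^{(t)};\theta^{(t)})-\mathcal E_\diamond^{\nu^{(t)}}(w_{\diamond,\star}^{(t)};\theta^{(t)})]$. Transfer error: $\mathcal E_{\diamond,\mathrm{bias}}^{(t)}=\mathbb E[\mathcal E_\diamond^{\nu^\star}(w_{\diamond,\star}^{(t)};\theta^{(t)})]$. Expectations are over the randomness of the computed $w_\diamond^{(t)}$. Relative condition number: $\Sigma_\nu=\mathbb E_{(s,a)\sim\nu}[\phi_{s,a}\phi_{s,a}^\top]$ and $\kappa=\sup_{w\in\mathbb R^d}\frac{w^\top\Sigma_{\nu^\star}w}{w^\top\Sigma_{\nu_0}w}$ (convention $0/0=0$, $c/0=+\infty$ for $c>0$).
   Formalization: The algorithm is taken to start at θ^(0)=0 (uniform policy) and λ^(0)=0, which the statement does not specify; for an arbitrary initialization the stated bounds fail. *)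

(* Defs.v *)
From HB Require Import structures.
From mathcomp Require Import all_boot all_order all_algebra.
From mathcomp Require Import all_classical all_reals all_analysis.

Set Implicit Arguments.
Unset Strict Implicit.
Unset Printing Implicit Defensive.

Import Order.TTheory GRing.Theory Num.Theory.
Import numFieldNormedType.Exports.

Local Open Scope classical_set_scope.
Local Open Scope ring_scope.

Section Vectors.
Context {R : realType} {d : nat}.

Definition dotv (u v : 'cV[R]_d) : R := (u^T *m v) 0 0.

(* The norm [`|v|] that the library puts on matrices is the sup norm, hence
   this Euclidean norm. *)
Definition norm2 (v : 'cV[R]_d) : R := Num.sqrt (dotv v v).

Definition quad_form (A : 'M[R]_d) (v : 'cV[R]_d) : R := (v^T *m A *m v) 0 0.

End Vectors.

Definition is_dist {R : realType} {X : finType} (p : X -> R) : Prop :=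
  (forall x, 0 <= p x) /\ \sum_x p x = 1.

Definition positive_part {R : realType} (x : R) : R := Num.max x 0.

Definition is_projection {R : realType} (L : set R) (x y : R) : Prop :=
  L y /\ forall z, L z -> `|x - y| <= `|x - z|.

Inductive signal := Reward | Utility.

Record cmdp (R : realType) (S A : finType) := Cmdp {
  trans : S -> A -> S -> R;   (* [trans s a s'] is P(s' | s, a) *)
  payoff : signal -> S -> A -> R;
  disc : R;
  thr : R;
  trans_dist : forall s a, is_dist (trans s a);
  payoff_ge0 : forall x s a, 0 <= payoff x s a;
  payoff_le1 : forall x s a, payoff x s a <= 1;
  disc_ge0 : 0 <= disc;
  disc_lt1 : disc < 1;
  thr_gt0 : 0 < thr;
  thr_le : thr <= (1 - disc)^-1 }.

Section Cmdp.
Context {R : realType} {S A : finType} (M : cmdp R S A).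
Local Notation gamma := (disc M).

(* [pi s a] is the probability pi(a | s). *)
Definition is_policy (pi : S -> A -> R) : Prop := forall s, is_dist (pi s).

Section Trajectories.
Variable pi : S -> A -> R.

(* Probability of the state-action trajectory tau = ((s_0,a_0),...,(s_n,a_n))
   when (s_0,a_0) has law [mu] and the policy [pi] is followed afterwards. *)
Definition traj_prob (mu : S * A -> R) (n : nat)
    (tau : {ffun 'I_n.+1 -> S * A}) : R :=
  mu (tau ord0) *
  \prod_(i < n)
     (let z := tau (widen_ord (leqnSn n) i) in
      let z' := tau (lift ord0 i) in
      trans M z.1 z.2 z'.1 * pi z'.1 z'.2).

Definition traj_expect (mu : S * A -> R) (n : nat)
    (F : {ffun 'I_n.+1 -> S * A} -> R) : R :=
  \sum_(tau : {ffun 'I_n.+1 -> S * A}) traj_prob mu tau * F tau.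

(* The payoffs are nonnegative, so the expectation of the infinite discounted
   sum is the limit of the expectations of its partial sums. *)
Definition discounted_return (x : signal) (mu : S * A -> R) : R :=
  limn (fun n => traj_expect mu (fun tau : {ffun 'I_n.+1 -> S * A} =>
    \sum_(t < n.+1) gamma ^+ t * payoff M x (tau t).1 (tau t).2)).

Definition start_s (s0 : S) (z : S * A) : R := (z.1 == s0)%:R * pi z.1 z.2.

Definition start_sa (z0 z : S * A) : R := (z == z0)%:R.

Definition Vs (x : signal) (s : S) : R := discounted_return x (start_s s).

Definition Q (x : signal) (z : S * A) : R := discounted_return x (start_sa z).

Definition V (x : signal) (rho : S -> R) : R := \sum_s rho s * Vs x s.

Definition prob_s (s0 : S) (t : nat) (s : S) : R :=
  traj_expect (start_s s0)
    (fun tau : {ffun 'I_t.+1 -> S * A} => ((tau ord_max).1 == s)%:R).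

Definition prob_sa (z0 : S * A) (t : nat) (z : S * A) : R :=
  traj_expect (start_sa z0)
    (fun tau : {ffun 'I_t.+1 -> S * A} => (tau ord_max == z)%:R).

Definition visit_s (rho : S -> R) (s : S) : R :=
  (1 - gamma) * \sum_s0 rho s0 *
    limn (series (fun t => gamma ^+ t * prob_s s0 t s)).

Definition visit_sa (nu0 : S * A -> R) (z : S * A) : R :=
  (1 - gamma) * \sum_z0 nu0 z0 *
    limn (series (fun t => gamma ^+ t * prob_sa z0 t z)).

End Trajectories.

Definition slater (rho : S -> R) (xi : R) : Prop :=
  0 < xi /\
  exists pibar, is_policy pibar /\ xi <= V pibar Utility rho - thr M.

Definition is_optimal (rho : S -> R) (pi : S -> A -> R) : Prop :=
  [/\ is_policy pi, thr M <= V pi Utility rho &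
      forall pi', is_policy pi' -> thr M <= V pi' Utility rho ->
        V pi' Reward rho <= V pi Reward rho].

Section LogLinear.
Context {d : nat} (phi : S * A -> 'cV[R]_d).

Definition loglinear (theta : 'cV[R]_d) (s : S) (a : A) : R :=
  expR (dotv theta (phi (s, a))) /
  \sum_a' expR (dotv theta (phi (s, a'))).

Definition regr_error (x : signal) (nu : S * A -> R) (w theta : 'cV[R]_d) : R :=
  \sum_z nu z * (Q (loglinear theta) x z - dotv w (phi z)) ^+ 2.

Definition is_regr_argmin (W : R) (x : signal) (nu : S * A -> R)
    (theta w : 'cV[R]_d) : Prop :=
  norm2 w <= W /\
  forall w', norm2 w' <= W -> regr_error x nu w theta <= regr_error x nu w' theta.

Definition nu_t (nu0 : S * A -> R) (theta : 'cV[R]_d) : S * A -> R :=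
  visit_sa (loglinear theta) nu0.

Definition nu_star (rho : S -> R) (pistar : S -> A -> R) (z : S * A) : R :=
  visit_s pistar rho z.1 * #|A|%:R^-1.

Definition feature_cov (nu : S * A -> R) : 'M[R]_d :=
  \sum_z nu z *: (phi z *m (phi z)^T).

Definition quad_ratio (x y : R) : \bar R :=
  if y == 0 then (if x == 0 then 0%E else +oo%E) else (x / y)%:E.

Definition rel_cond_number (nus nu0 : S * A -> R) : \bar R :=
  ereal_sup [set quad_ratio (quad_form (feature_cov nus) w)
                            (quad_form (feature_cov nu0) w) | w in [set: 'cV[R]_d]].

(* One realization of the run; the iterates start at theta = 0 (the uniform
   policy) and lambda = 0. *)
Record npg_pd_run (rho : S -> R) (xi W eta1 eta2 : R)
    (w : signal -> nat -> 'cV[R]_d)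
    (theta : nat -> 'cV[R]_d) (lambda : nat -> R) : Prop := {
  run_theta0 : theta 0%N = 0;
  run_lambda0 : lambda 0%N = 0;
  run_w : forall x t, norm2 (w x t) <= W;
  run_theta : forall t, theta t.+1 =
    theta t + (eta1 / (1 - gamma)) *: (w Reward t + lambda t *: w Utility t);
  run_lambda : forall t,
    is_projection `[0, 2 / ((1 - gamma) * xi)]
      (lambda t - eta2 * (V (loglinear (theta t)) Utility rho - thr M))
      (lambda t.+1) }.

End LogLinear.
End Cmdp.

Definition random_vector {dO : measure_display} {Omega : measurableType dO}
    {R : realType} {d : nat} (X : Omega -> 'cV[R]_d) : Prop :=
  forall i, measurable_fun [set: Omega] (fun omega => X omega i 0).

(* Main.v *)
Require Import Defs.
From HB Require Import structures.
From mathcomp Require Import all_boot all_order all_algebra.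
From mathcomp Require Import all_classical all_reals all_analysis.
From mathcomp Require Import measurable_realfun ring lra.

(** Write D(t) for the cross entropy of pi* relative to pi^(t), averaged over the
    state visitation distribution of pi*. The update is an additive shift of the
    log-linear parameter, so Hoeffding's lemma for the log-partition function and
    the performance difference lemma bound the Lagrangian gap of step t by
    D(t) - D(t+1), up to O(eta^2) and the error of the regressed Q-functions.
    That error is controlled under nu* by splitting the computed weights into the
    exact minimizer (transfer error) and the deviation from it; first-order
    optimality over the ball bounds the deviation in the nu^(t)-seminorm by the
    estimation error, and nu^(t) >= (1 - gamma) nu0 together with kappa carries it
    over to nu*. Adding the dual inequality
    (lambda(t+1) - l)^2 <= (lambda(t) - l - eta (V_g - b))^2 and telescoping gives
    a regret bound for each l in [0, 2 / ((1 - gamma) xi)]: l = 0 is the optimality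
    gap. For the violation v take l at the right end; strong duality is replaced by
    mixing occupancy measures: giving the Slater policy weight v / (v + xi) makes
    the averaged iterates feasible, so their reward exceeds V_r* by at most
    v / (xi (1 - gamma)). *)

Set Implicit Arguments.
Unset Strict Implicit.
Unset Printing Implicit Defensive.

Import Order.TTheory GRing.Theory Num.Theory.
Import numFieldNormedType.Exports.

Local Open Scope classical_set_scope.
Local Open Scope ring_scope.

(** * Occupancy measures *)

Section FinfunRcons.
Context {X : Type} {n : nat}.

(** Trajectories grow at their end, so that induction on the horizon splits off the last
    transition. *)
Definition ffun_rcons (tau : {ffun 'I_n -> X}) (x : X) : {ffun 'I_n.+1 -> X} :=
  [ffun i => if unlift ord_max i is Some j then tau j else x].

Lemma ffun_rcons_max tau x : ffun_rcons tau x ord_max = x.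
Proof. by rewrite ffunE unlift_none. Qed.

Lemma ffun_rcons_val tau x (i : 'I_n.+1) (j : 'I_n) :
  i = j :> nat -> ffun_rcons tau x i = tau j.
Proof.
move=> ij; have -> : i = lift ord_max j by apply: ord_inj; rewrite lift_max.
by rewrite ffunE liftK.
Qed.

End FinfunRcons.

Lemma sum_ffun_recr {V : nmodType} {X : finType} {n : nat}
    (F : {ffun 'I_n.+1 -> X} -> V) :
  \sum_tau F tau = \sum_(tau : {ffun 'I_n -> X}) \sum_x F (ffun_rcons tau x).
Proof.
rewrite pair_bigA /=.
rewrite (reindex (fun p : {ffun 'I_n -> X} * X => ffun_rcons p.1 p.2)) //=.
exists (fun tau => ([ffun j => tau (lift ord_max j)], tau ord_max)).
  move=> [tau x] _ /=; congr (_, _); last by rewrite ffun_rcons_max.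
  by apply/ffunP => j; rewrite ffunE /ffun_rcons ffunE liftK.
move=> tau _ /=; apply/ffunP => i; rewrite ffunE.
by case: unliftP => [j ->|->] //=; rewrite ffunE.
Qed.

Lemma sum_pair {V : nmodType} {X Y : finType} (f : X * Y -> V) :
  \sum_z f z = \sum_x \sum_y f (x, y).
Proof. by rewrite pair_bigA /=; apply: eq_bigr => -[]. Qed.

(** * The state-action chain of a policy and its discounted occupancy measure *)

Section MarkovChain.
Context {R : realType} {S A : finType} (M : cmdp R S A).
Implicit Types (pi : S -> A -> R) (mu q : S * A -> R) (z : S * A).
Local Notation gamma := (disc M).

Definition kernel pi (z z' : S * A) : R := trans M z.1 z.2 z'.1 * pi z'.1 z'.2.

Definition push pi mu (z' : S * A) : R := \sum_z mu z * kernel pi z z'.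

Definition law pi mu (n : nat) : S * A -> R := iter n (push pi) mu.
Arguments law : simpl never.

Lemma lawS pi mu n z' :
  law pi mu n.+1 z' = \sum_z law pi mu n z * kernel pi z z'.
Proof. by []. Qed.

Lemma kernel_dist pi z : is_policy pi -> is_dist (kernel pi z).
Proof.
move=> hpi; split=> [z'|].
  by rewrite mulr_ge0 //; [case: (trans_dist M z.1 z.2)|case: (hpi z'.1)].
rewrite -(pair_bigA _ (fun s a => trans M z.1 z.2 s * pi s a)) /=.
rewrite -(trans_dist M z.1 z.2).2; apply: eq_bigr => s _.
by rewrite -big_distrr /= (hpi s).2 mulr1.
Qed.

Lemma traj_prob_rcons pi mu n (tau : {ffun 'I_n.+1 -> S * A}) z :
  traj_prob M pi mu (ffun_rcons tau z) =
  traj_prob M pi mu tau * kernel pi (tau ord_max) z.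
Proof.
rewrite /traj_prob big_ord_recr /= mulrA; congr (_ * _ * _).
- by rewrite (@ffun_rcons_val _ _ _ _ _ ord0).
- apply: eq_bigr => i _.
  rewrite (@ffun_rcons_val _ _ _ _ _ (widen_ord (leqnSn n) i)) //.
  by rewrite (@ffun_rcons_val _ _ _ _ _ (lift ord0 i)).
- rewrite (@ffun_rcons_val _ _ _ _ _ ord_max) //.
  have -> : lift ord0 ord_max = ord_max :> 'I_n.+2 by exact: val_inj.
  by rewrite ffun_rcons_max.
Qed.

(** Summing out all entries but the last leaves the iterated kernel; the induction moves the last
    transition into the test function [f]. *)
Lemma traj_expect_last pi mu n (f : S * A -> R) :
  traj_expect M pi mu (fun tau : {ffun 'I_n.+1 -> S * A} => f (tau ord_max)) =
  \sum_z law pi mu n z * f z.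
Proof.
elim: n f => [|n IH] f; rewrite /traj_expect.
  rewrite sum_ffun_recr exchange_big /=; apply: eq_bigr => z _.
  rewrite (big_pred1 [ffun i : 'I_0 => z]) => [|tau]; last first.
    by rewrite /= eq_sym; apply/esym/eqP/ffunP => -[].
  rewrite ffun_rcons_max /traj_prob big_ord0 mulr1; congr (mu _ * _).
  have -> : ord0 = ord_max :> 'I_1 by exact: val_inj.
  by rewrite ffun_rcons_max.
rewrite sum_ffun_recr /=.
under eq_bigr => tau _.
  under eq_bigr do rewrite traj_prob_rcons ffun_rcons_max -mulrA.
  rewrite -big_distrr /=; over.
have /= := IH (fun y => \sum_z kernel pi y z * f z).
rewrite /traj_expect => ->.
under eq_bigr do rewrite big_distrr /=.
rewrite exchange_big /=; apply: eq_bigr => z _.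
by rewrite big_distrl /=; apply: eq_bigr => y _; rewrite mulrA.
Qed.

(** The last transition sums to one, so ignoring the last entry is the same as shortening the
    trajectory. *)
Lemma traj_expect_rcons pi mu n (F : {ffun 'I_n.+2 -> S * A} -> R)
    (G : {ffun 'I_n.+1 -> S * A} -> R) :
  is_policy pi -> (forall tau z, F (ffun_rcons tau z) = G tau) ->
  traj_expect M pi mu F = traj_expect M pi mu G.
Proof.
move=> hpi FG; rewrite /traj_expect sum_ffun_recr; apply: eq_bigr => tau _.
under eq_bigr do rewrite traj_prob_rcons FG mulrAC.
by rewrite -big_distrr /= (kernel_dist _ hpi).2 mulr1.
Qed.

Lemma traj_expect_sum pi mu (f : nat -> S * A -> R) n : is_policy pi ->
  traj_expect M pi mu
    (fun tau : {ffun 'I_n.+1 -> S * A} => \sum_(t < n.+1) f t (tau t)) =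
  \sum_(t < n.+1) \sum_z law pi mu t z * f t z.
Proof.
move=> hpi; elim: n => [|n IH].
  rewrite big_ord1 -traj_expect_last; apply: eq_bigr => tau _.
  by rewrite big_ord1; congr (_ * f _ (tau _)); exact: val_inj.
rewrite [RHS]big_ord_recr /= -IH -traj_expect_last.
rewrite -(@traj_expect_rcons _ _ _ (fun tau : {ffun 'I_n.+2 -> S * A} =>
  \sum_(t < n.+1) f t (tau (widen_ord (leqnSn n.+1) t)))) //; last first.
  move=> tau z; apply: eq_bigr => t _.
  by rewrite (@ffun_rcons_val _ _ _ _ _ t).
rewrite /traj_expect -big_split /=; apply: eq_bigr => tau _.
by rewrite big_ord_recr /= mulrDr.
Qed.

Lemma push_dist pi mu : is_policy pi -> is_dist mu -> is_dist (push pi mu).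
Proof.
move=> hpi hmu; split=> [z|].
  by apply: sumr_ge0 => y _; rewrite mulr_ge0 ?hmu.1 // (kernel_dist y hpi).1.
rewrite /push exchange_big /= -hmu.2; apply: eq_bigr => y _.
by rewrite -big_distrr /= (kernel_dist _ hpi).2 mulr1.
Qed.

Lemma law_dist pi mu n : is_policy pi -> is_dist mu -> is_dist (law pi mu n).
Proof. by move=> hpi hmu; elim: n => //= n; exact: push_dist. Qed.

Lemma dist_le1 (X : finType) (p : X -> R) x : is_dist p -> p x <= 1.
Proof.
move=> [p0 <-]; rewrite (bigD1 x) //= lerDl.
by apply: sumr_ge0 => y _; exact: p0.
Qed.

(** The unnormalized discounted occupancy measure: for a policy and an initial distribution its mass
    is 1 / (1 - gamma), and [visit_sa] is 1 - gamma times it. *)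
Definition occ pi mu z : R :=
  limn (series (fun t => gamma ^+ t * law pi mu t z)).

Lemma occ_cvg pi mu z : is_policy pi -> is_dist mu ->
  series (fun t => gamma ^+ t * law pi mu t z) @ \oo --> occ pi mu z.
Proof.
move=> hpi hmu.
have g0 := disc_ge0 M; have g1 := disc_lt1 M.
suff : cvgn (series (fun t => gamma ^+ t * law pi mu t z)) by [].
apply: (@series_le_cvg _ _ (geometric 1 gamma)).
- by move=> n; rewrite mulr_ge0 ?exprn_ge0 // (law_dist n hpi hmu).1.
- by move=> n; rewrite /= mul1r exprn_ge0.
- move=> n; rewrite /= mul1r ler_piMr ?exprn_ge0 //.
  by apply: dist_le1; exact: law_dist.
- by apply: is_cvg_geometric_series; rewrite ger0_norm.
Qed.

Lemma cvg_sum_mul (X : finType) (u : X -> nat -> R) (l f : X -> R) :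
  (forall x, u x @ \oo --> l x) ->
  (fun n => \sum_x u x n * f x) @ \oo --> \sum_x l x * f x.
Proof.
move=> ul; apply: (@cvg_big _ _ _ _ _ add_continuous _ _ _ (fun x n => u x n * f x)) => x _.
by apply: cvgMl; exact: ul.
Qed.

Lemma occ_ge0 pi mu z : is_policy pi -> is_dist mu -> 0 <= occ pi mu z.
Proof.
move=> hpi hmu; apply: limr_ge; first exact: occ_cvg.
near=> n; apply: sumr_ge0 => i _.
by rewrite mulr_ge0 ?exprn_ge0 ?disc_ge0 // (law_dist i hpi hmu).1.
Unshelve. all: by end_near. Qed.

(** Both sides are limits of the partial sums shifted by one index: the term t = 0 is [mu], and
    every later law is one application of the kernel. *)
Lemma occ_flow pi mu z' : is_policy pi -> is_dist mu ->
  occ pi mu z' = mu z' + gamma * \sum_z occ pi mu z * kernel pi z z'.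
Proof.
move=> hpi hmu.
pose u z n := series (fun t => gamma ^+ t * law pi mu t z) n.
have uS n : u z' n.+1 = mu z' + gamma * \sum_z u z n * kernel pi z z'.
  rewrite /u /series /= big_nat_recl //= expr0 mul1r; congr (_ + _).
  under [X in _ = _ * X]eq_bigr do rewrite big_distrl /=.
  rewrite exchange_big big_distrr /=; apply: eq_bigr => t _.
  rewrite lawS exprS -mulrA; congr (_ * _).
  by rewrite big_distrr /=; apply: eq_bigr => z _; rewrite mulrA.
have lim1 : (fun n => u z' n.+1) @ \oo --> occ pi mu z'.
  by rewrite (cvg_shiftS (u z')); exact: occ_cvg.
have lim2 : (fun n => u z' n.+1) @ \oo -->
    mu z' + gamma * \sum_z occ pi mu z * kernel pi z z'.
  under eq_cvg do rewrite uS.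
  apply: cvgD; first exact: cvg_cst.
  by apply: cvgMr; apply: cvg_sum_mul => z; exact: occ_cvg.
exact: cvg_unique lim1 lim2.
Qed.

(* The flow equations contract l^1 by the factor [disc M]. *)
Lemma occ_unique pi mu q : is_policy pi -> is_dist mu ->
  (forall z', q z' = mu z' + gamma * \sum_z q z * kernel pi z z') ->
  q =1 occ pi mu.
Proof.
move=> hpi hmu hq.
have g0 := disc_ge0 M; have g1 := disc_lt1 M.
pose h z := q z - occ pi mu z.
have hE z' : h z' = gamma * \sum_z h z * kernel pi z z'.
  rewrite /h {1}hq {1}occ_flow // opprD addrACA subrr add0r -mulrBr -sumrB.
  by congr (_ * _); apply: eq_bigr => z _; rewrite mulrBl.
have nh : \sum_z `|h z| <= gamma * \sum_z `|h z|.
  apply: (@le_trans _ _ (\sum_z' gamma * \sum_z `|h z| * kernel pi z z')).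
    apply: ler_sum => z' _; rewrite {1}hE normrM (ger0_norm g0).
    rewrite ler_wpM2l //; apply: le_trans (ler_norm_sum _ _ _) _.
    apply: ler_sum => z _; rewrite normrM (@ger0_norm _ (kernel _ _ _)) //.
    exact: (kernel_dist z hpi).1.
  rewrite -big_distrr /= exchange_big /= ler_wpM2l //.
  apply: ler_sum => z _.
  by rewrite -big_distrr /= (kernel_dist z hpi).2 mulr1.
have s0 : \sum_z `|h z| <= 0.
  have : 0 <= \sum_z `|h z| by apply: sumr_ge0 => z _; exact: normr_ge0.
  by move=> S0; nra.
move=> z; apply/eqP; rewrite -subr_eq0 -normr_le0 -/(h z).
apply: le_trans s0; rewrite (bigD1 z) //= lerDl.
by apply: sumr_ge0 => ? _; exact: normr_ge0.
Qed.

Lemma dist_mix (X I : finType) (c : I -> R) (p : I -> X -> R) :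
  is_dist c -> (forall i, is_dist (p i)) -> is_dist (fun x => \sum_i c i * p i x).
Proof.
move=> hc hp; split=> [x|].
  by apply: sumr_ge0 => i _; rewrite mulr_ge0 ?hc.1 ?(hp i).1.
rewrite exchange_big -hc.2; apply: eq_bigr => i _.
by rewrite -big_distrr /= (hp i).2 mulr1.
Qed.

(** The mixture on the right solves the flow equations of the mixed initial law, and [occ_unique]
    concludes without touching limits. *)
Lemma occ_mix (I : finType) (c : I -> R) (mu : I -> S * A -> R) pi z :
  is_policy pi -> is_dist c -> (forall i, is_dist (mu i)) ->
  occ pi (fun z => \sum_i c i * mu i z) z = \sum_i c i * occ pi (mu i) z.
Proof.
move=> hpi hc hmu; apply/esym.
apply: (@occ_unique pi _ (fun z => \sum_i c i * occ pi (mu i) z)) => //.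
  exact: dist_mix.
move=> z'; under eq_bigr => i _ do rewrite occ_flow // mulrDr.
rewrite big_split /=; congr (_ + _).
under [X in _ = _ * X]eq_bigr do rewrite big_distrl /=.
rewrite exchange_big big_distrr /=; apply: eq_bigr => i _.
rewrite mulrCA; congr (_ * _); rewrite big_distrr /=.
by apply: eq_bigr => y _; rewrite mulrA.
Qed.

(** First-step decomposition: the right-hand side solves the flow equations started at [mu]. *)
Lemma occ_push pi mu z : is_policy pi -> is_dist mu ->
  occ pi mu z = mu z + gamma * occ pi (push pi mu) z.
Proof.
move=> hpi hmu; apply/esym.
apply: (@occ_unique pi _ (fun z => mu z + gamma * occ pi (push pi mu) z)) => //.
move=> z'; congr (_ + _ * _); rewrite occ_flow //; last exact: push_dist.
under [RHS]eq_bigr do rewrite mulrDl.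
rewrite big_split /=; congr (_ + _); rewrite big_distrr /=.
by apply: eq_bigr => y _; rewrite mulrA.
Qed.

(** Makes every return a linear functional of the occupancy measure, the form from which values,
    Bellman equations and mixtures are derived. *)
Lemma discounted_returnE pi x mu : is_policy pi -> is_dist mu ->
  discounted_return M pi x mu = \sum_z occ pi mu z * payoff M x z.1 z.2.
Proof.
move=> hpi hmu; apply: cvg_lim => //.
(* Horizon [n] carries n + 1 payoffs, hence the partial sum of index [n.+1]. *)
rewrite (_ : (fun n => _) = (fun n => \sum_z
    series (fun t => gamma ^+ t * law pi mu t z) n.+1 * payoff M x z.1 z.2)).
  apply: (@cvg_sum_mul _ (fun z n => series _ n.+1)) => z.
  rewrite (cvg_shiftS (series (fun t => gamma ^+ t * law pi mu t z))).
  exact: occ_cvg.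
apply/funext => n.
rewrite (@traj_expect_sum _ _ (fun t z => gamma ^+ t * payoff M x z.1 z.2)) //.
under [RHS]eq_bigr do rewrite /series /= big_mkord big_distrl /=.
rewrite [RHS]exchange_big /=; apply: eq_bigr => t _; apply: eq_bigr => z _.
by rewrite mulrCA mulrA.
Qed.

Definition start pi (rho : S -> R) (z : S * A) : R := rho z.1 * pi z.1 z.2.

Lemma start_dist pi rho : is_policy pi -> is_dist rho -> is_dist (start pi rho).
Proof.
move=> hpi hrho; split=> [z|]; first by rewrite mulr_ge0 ?hrho.1 ?(hpi z.1).1.
rewrite -(pair_bigA _ (fun s a => rho s * pi s a)) /= -hrho.2.
by apply: eq_bigr => s _; rewrite -big_distrr /= (hpi s).2 mulr1.
Qed.

Lemma dirac_dist (X : finType) (x0 : X) : is_dist (fun x => (x == x0)%:R : R).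
Proof.
split=> [x|]; first exact: ler0n.
by rewrite (bigD1 x0) //= eqxx big1 ?addr0 // => i /negbTE ->.
Qed.

Lemma start_s_dist pi s : is_policy pi -> is_dist (start_s pi s).
Proof.
move=> hpi.
exact: (@start_dist pi (fun s' => (s' == s)%:R) hpi (dirac_dist s)).
Qed.

Lemma start_sa_dist z : is_dist (start_sa z : S * A -> R).
Proof. exact: dirac_dist. Qed.

Lemma sum_dirac (X : finType) (f : X -> R) x0 :
  \sum_x f x * (x0 == x)%:R = f x0.
Proof.
rewrite (bigD1 x0) //= eqxx mulr1 big1 ?addr0 // => i /negbTE.
by rewrite eq_sym => ->; rewrite mulr0.
Qed.

Lemma occ_start_s pi rho z : is_policy pi -> is_dist rho ->
  occ pi (start pi rho) z = \sum_s rho s * occ pi (start_s pi s) z.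
Proof.
move=> hpi hrho; rewrite -occ_mix //; last by move=> s; exact: start_s_dist.
congr (occ _ _ _); apply/funext => y; rewrite /start /start_s.
under eq_bigr do rewrite mulrA.
by rewrite -big_distrl /= sum_dirac.
Qed.

Lemma occ_start_sa pi mu z : is_policy pi -> is_dist mu ->
  occ pi mu z = \sum_y mu y * occ pi (start_sa y) z.
Proof.
move=> hpi hmu; rewrite -occ_mix //; last by move=> y; exact: start_sa_dist.
congr (occ _ _ _); apply/funext => y; rewrite /start_sa.
by rewrite sum_dirac.
Qed.

Lemma V_occ pi x rho : is_policy pi -> is_dist rho ->
  V M pi x rho = \sum_z occ pi (start pi rho) z * payoff M x z.1 z.2.
Proof.
move=> hpi hrho; rewrite /V.
under eq_bigr => s _.
  rewrite /Vs discounted_returnE //; last exact: start_s_dist.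
  rewrite big_distrr /=; over.
rewrite exchange_big /=; apply: eq_bigr => z _.
by rewrite occ_start_s // big_distrl /=; apply: eq_bigr => s _; rewrite mulrA.
Qed.

Lemma return_start_sa pi x mu : is_policy pi -> is_dist mu ->
  discounted_return M pi x mu = \sum_z mu z * Q M pi x z.
Proof.
move=> hpi hmu; rewrite discounted_returnE //.
under [RHS]eq_bigr => z _.
  rewrite /Q discounted_returnE //; last exact: start_sa_dist.
  rewrite big_distrr /=; over.
rewrite exchange_big /=; apply: eq_bigr => z _.
by rewrite occ_start_sa // big_distrl /=; apply: eq_bigr => s _; rewrite mulrA.
Qed.

Lemma Vs_Q pi x s : is_policy pi ->
  Vs M pi x s = \sum_a pi s a * Q M pi x (s, a).
Proof.
move=> hpi; rewrite /Vs return_start_sa //; last exact: start_s_dist.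
rewrite -(pair_bigA _ (fun s' a => start_s pi s (s', a) * Q M pi x (s', a))) /=.
rewrite (bigD1 s) //= [X in _ + X]big1 ?addr0 => [|s' /negbTE ns].
  by apply: eq_bigr => a _; rewrite /start_s /= eqxx mul1r.
by rewrite big1 // => a _; rewrite /start_s /= ns !mul0r.
Qed.

(** From the Dirac mass at [z], [occ_push] separates the immediate payoff from the return of the
    pushed law, whose actions are drawn from [pi]. *)
Lemma Q_bellman pi x z : is_policy pi ->
  Q M pi x z =
  payoff M x z.1 z.2 + gamma * \sum_s trans M z.1 z.2 s * Vs M pi x s.
Proof.
move=> hpi; have dz := start_sa_dist z.
rewrite {1}/Q discounted_returnE //.
under eq_bigr do rewrite occ_push // mulrDl -mulrA.
rewrite big_split -big_distrr /=; congr (_ + _ * _).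
  under eq_bigr do rewrite /start_sa eq_sym mulrC.
  exact: sum_dirac.
rewrite -discounted_returnE //; last exact: push_dist.
rewrite return_start_sa //; last exact: push_dist.
under [RHS]eq_bigr do rewrite Vs_Q // big_distrr /=.
rewrite pair_bigA /=; apply: eq_bigr => -[s a] _ /=.
rewrite mulrA; congr (_ * _); rewrite /push.
under eq_bigr do rewrite /start_sa eq_sym mulrC.
by rewrite sum_dirac.
Qed.

(** Summing the flow equations gives m = 1 + gamma m for the total mass m. *)
Lemma occ_mass pi mu : is_policy pi -> is_dist mu ->
  \sum_z occ pi mu z = (1 - gamma)^-1.
Proof.
move=> hpi hmu; have g1 := disc_lt1 M.
have : \sum_z occ pi mu z = 1 + gamma * \sum_z occ pi mu z.
  rewrite -[X in _ = X + _]hmu.2 big_distrr -big_split /=.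
  under eq_bigr do rewrite occ_flow // big_distrr /=.
  rewrite big_split exchange_big /= -big_split /=; apply: eq_bigr => z _.
  congr (_ + _).
  by rewrite -big_distrr -big_distrr /= (kernel_dist z hpi).2 mulr1.
move=> h; apply: (@mulfI _ (1 - gamma)); first by rewrite subr_eq0 gt_eqF.
by rewrite mulfV ?subr_eq0 ?gt_eqF // mulrBl mul1r {1}h addrK.
Qed.

Lemma return_ge0 pi x mu : is_policy pi -> is_dist mu ->
  0 <= discounted_return M pi x mu.
Proof.
move=> hpi hmu; rewrite discounted_returnE //; apply: sumr_ge0 => z _.
by rewrite mulr_ge0 ?payoff_ge0 ?occ_ge0.
Qed.

Lemma return_le pi x mu : is_policy pi -> is_dist mu ->
  discounted_return M pi x mu <= (1 - gamma)^-1.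
Proof.
move=> hpi hmu; rewrite discounted_returnE // -(occ_mass hpi hmu).
by apply: ler_sum => z _; rewrite ler_piMr ?payoff_le1 ?occ_ge0.
Qed.

Lemma V_return pi x rho : is_policy pi -> is_dist rho ->
  V M pi x rho = discounted_return M pi x (start pi rho).
Proof.
by move=> hpi hrho; rewrite V_occ // discounted_returnE //; exact: start_dist.
Qed.

Lemma V_ge0 pi x rho : is_policy pi -> is_dist rho -> 0 <= V M pi x rho.
Proof.
by move=> hpi hrho; rewrite V_return // return_ge0 //; exact: start_dist.
Qed.

Lemma V_le pi x rho : is_policy pi -> is_dist rho ->
  V M pi x rho <= (1 - gamma)^-1.
Proof.
by move=> hpi hrho; rewrite V_return // return_le //; exact: start_dist.
Qed.

Definition socc pi rho s : R := \sum_a occ pi (start pi rho) (s, a).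

Lemma socc_ge0 pi rho s : is_policy pi -> is_dist rho -> 0 <= socc pi rho s.
Proof.
move=> hpi hrho; apply: sumr_ge0 => a _.
by apply: occ_ge0 => //; exact: start_dist.
Qed.

(** When the first action is drawn from [pi], the initial term and the inflow both carry the factor
    [pi s a]; hence the disintegration in [occ_socc]. *)
Lemma occ_startE pi rho s a : is_policy pi -> is_dist rho ->
  occ pi (start pi rho) (s, a) = (rho s + gamma *
    \sum_z occ pi (start pi rho) z * trans M z.1 z.2 s) * pi s a.
Proof.
move=> hpi hrho; rewrite {1}occ_flow //; last exact: start_dist.
rewrite mulrDl; congr (_ + _); rewrite -mulrA big_distrl /=.
by congr (_ * _); apply: eq_bigr => z _; rewrite mulrA.
Qed.

Lemma socc_flow pi rho s : is_policy pi -> is_dist rho ->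
  socc pi rho s =
  rho s + gamma * \sum_z occ pi (start pi rho) z * trans M z.1 z.2 s.
Proof.
move=> hpi hrho; rewrite /socc; under eq_bigr do rewrite occ_startE //.
by rewrite -big_distrr /= (hpi s).2 mulr1.
Qed.

Lemma occ_socc pi rho s a : is_policy pi -> is_dist rho ->
  occ pi (start pi rho) (s, a) = socc pi rho s * pi s a.
Proof. by move=> hpi hrho; rewrite occ_startE // socc_flow. Qed.

Lemma socc_mass pi rho : is_policy pi -> is_dist rho ->
  \sum_s socc pi rho s = (1 - gamma)^-1.
Proof.
move=> hpi hrho; by rewrite -(occ_mass hpi (start_dist hpi hrho)) sum_pair.
Qed.

Lemma visit_sE pi rho s : is_policy pi -> is_dist rho ->
  visit_s M pi rho s = (1 - gamma) * socc pi rho s.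
Proof.
move=> hpi hrho; congr (_ * _).
under [RHS]eq_bigr do rewrite occ_start_s //.
rewrite exchange_big; apply: eq_bigr => s0 _; rewrite -big_distrr /=.
congr (_ * _); apply: cvg_lim => //.
have hs0 := start_s_dist s0 hpi.
have -> : \sum_a occ pi (start_s pi s0) (s, a) =
    \sum_z occ pi (start_s pi s0) z * (z.1 == s)%:R.
  rewrite sum_pair.
  rewrite (bigD1 s) //= [X in _ + X]big1 ?addr0 => [|s' /negbTE ns].
    by apply: eq_bigr => a _; rewrite eqxx mulr1.
  by rewrite big1 // => a _; rewrite /= ns mulr0.
rewrite (_ : series _ = (fun n => \sum_z
    series (fun t => gamma ^+ t * law pi (start_s pi s0) t z) n * (z.1 == s)%:R)).
  by apply: (@cvg_sum_mul _ (fun z n => series _ n)) => z; exact: occ_cvg.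
apply/funext => n; rewrite /series /=.
under [RHS]eq_bigr do rewrite big_distrl /=.
rewrite [RHS]exchange_big /=; apply: eq_bigr => t _.
rewrite /prob_s (@traj_expect_last _ _ _ (fun z => (z.1 == s)%:R)) big_distrr /=.
by apply: eq_bigr => z _; rewrite mulrA.
Qed.

Lemma visit_saE pi mu z : is_policy pi -> is_dist mu ->
  visit_sa M pi mu z = (1 - gamma) * occ pi mu z.
Proof.
move=> hpi hmu; congr (_ * _); rewrite occ_start_sa //.
apply: eq_bigr => z0 _; congr (_ * _).
congr (limn (series _)); apply/funext => t; congr (_ * _).
rewrite /prob_sa (@traj_expect_last _ _ _ (fun y => (y == z)%:R)).
under eq_bigr do rewrite eq_sym.
exact: sum_dirac.
Qed.

(** Only the time-zero term is kept. A bound under the visitation distribution thus yields one under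
    [mu] at the price of 1 / (1 - gamma). *)
Lemma visit_sa_ge pi mu z : is_policy pi -> is_dist mu ->
  (1 - gamma) * mu z <= visit_sa M pi mu z.
Proof.
move=> hpi hmu; rewrite visit_saE //.
apply: ler_wpM2l; first by rewrite subr_ge0 ltW ?disc_lt1.
rewrite occ_flow // lerDl mulr_ge0 ?disc_ge0 //; apply: sumr_ge0 => y _.
by rewrite mulr_ge0 ?occ_ge0 // (kernel_dist y hpi).1.
Qed.

(** Bellman's equation expands Q, and the flow equations of [pi'] cancel the values of [pi] at
    successor states. The occupancy measure is unnormalized, so no factor 1 / (1 - gamma)
    appears. *)
Lemma performance_difference pi pi' x rho :
  is_policy pi -> is_policy pi' -> is_dist rho ->
  \sum_z occ pi' (start pi' rho) z * (Q M pi x z - Vs M pi x z.1) =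
  V M pi' x rho - V M pi x rho.
Proof.
move=> hpi hpi' hrho; set q := occ pi' _.
rewrite V_occ // -/q.
(* The state flow equation of [pi'], solved for [rho] and integrated against the value of [pi]. *)
have -> : V M pi x rho = \sum_s socc pi' rho s * Vs M pi x s -
    gamma * \sum_z q z * \sum_s trans M z.1 z.2 s * Vs M pi x s.
  rewrite /V; apply/eqP; rewrite eq_sym subr_eq; apply/eqP.
  under eq_bigr do rewrite socc_flow // mulrDl.
  rewrite big_split /=; congr (_ + _).
  under [LHS]eq_bigr do rewrite -mulrA big_distrl /=.
  rewrite -big_distrr exchange_big /=; congr (_ * _); apply: eq_bigr => z _.
  by rewrite big_distrr /=; apply: eq_bigr => s _; rewrite mulrA.
rewrite opprB addrA.
under eq_bigr do rewrite mulrBr Q_bellman // mulrDr mulrCA.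
rewrite big_split sumrN big_split /= -big_distrr /=; congr (_ + _ - _).
rewrite /socc; under [RHS]eq_bigr do rewrite big_distrl /=.
by rewrite sum_pair.
Qed.

(* The mixture of the occupancy measures is the occupancy measure of the policy
   obtained by conditioning it on the state. *)
Lemma V_mix (I : finType) (c : I -> R) (pi : I -> S -> A -> R) rho :
  is_dist c -> (forall i, is_policy (pi i)) -> is_dist rho ->
  exists2 pibar, is_policy pibar &
    forall x, V M pibar x rho = \sum_i c i * V M (pi i) x rho.
Proof.
move=> hc hpi hrho.
have [i0 _|I0] := pickP (fun _ : I => true); last first.
  by move: (hc.2); rewrite big_pred0 // => /esym/eqP; rewrite oner_eq0.
pose q z := \sum_i c i * occ (pi i) (start (pi i) rho) z.
have q0 z : 0 <= q z.
  by apply: sumr_ge0 => i _; rewrite mulr_ge0 ?hc.1 ?occ_ge0 //; exact: start_dist.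
pose m s := \sum_a q (s, a).
have m0 s : 0 <= m s by exact: sumr_ge0.
(* Conditioning fails at states of mass zero; any policy serves there, and [pi i0] exists because
   weights summing to one need an index. *)
pose pibar s a := if m s == 0 then pi i0 s a else q (s, a) / m s.
have hpibar : is_policy pibar.
  move=> s; rewrite /pibar; have [ms|ms] := eqVneq (m s) 0; first exact: hpi.
  by split=> [a|]; [rewrite divr_ge0|rewrite -big_distrl /= divff].
have mpi s a : q (s, a) = m s * pibar s a.
  rewrite /pibar; have [ms|ms] := eqVneq (m s) 0; last by rewrite mulrCA divff ?mulr1.
  by rewrite ms mul0r (psumr_eq0P (fun a _ => q0 (s, a)) ms).
have mE s : m s = rho s + gamma * \sum_z q z * trans M z.1 z.2 s.
  rewrite /m /q exchange_big /=.
  under eq_bigr => i _ do rewrite -big_distrr /= -/(socc (pi i) rho s) socc_flow // mulrDr.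
  rewrite big_split -big_distrl /= hc.2 mul1r; congr (_ + _).
  under [X in _ = _ * X]eq_bigr do rewrite big_distrl /=.
  rewrite exchange_big big_distrr /=; apply: eq_bigr => i _.
  rewrite mulrCA; congr (_ * _); rewrite big_distrr /=.
  by apply: eq_bigr => z _; rewrite mulrA.
(* By [mpi] and [mE], [q] solves the flow equations that characterize the occupancy measure of
   [pibar]. *)
have qocc : q =1 occ pibar (start pibar rho).
  apply: occ_unique => // [|[s a]]; first exact: start_dist.
  rewrite mpi mE mulrDl; congr (_ + _); rewrite -mulrA big_distrl /=.
  by congr (_ * _); apply: eq_bigr => z _; rewrite mulrA.
exists pibar => // x; rewrite V_occ //.
under eq_bigr do rewrite -qocc big_distrl /=.
rewrite exchange_big /=; apply: eq_bigr => i _; rewrite V_occ // big_distrr /=.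
by apply: eq_bigr => z _; rewrite mulrA.
Qed.

End MarkovChain.

(** * Hoeffding's lemma *)

Lemma is_derive_ge0 {R : realType} (f df : R -> R) :
  (forall x : R, is_derive x 1 f (df x)) -> (forall x, 0 <= x -> 0 <= df x) ->
  0 <= f 0 -> forall x, 0 <= x -> 0 <= f x.
Proof.
move=> fdf df0 f0 x x0.
have cf : {within `[0, x], continuous f}.
  apply: continuous_subspaceT => y; apply: differentiable_continuous.
  by apply/derivable1_diffP; case: (fdf y).
have [y /[!in_itv] /= /andP[y0 _]] := MVT_segment x0 (fun y _ => fdf y) cf.
by rewrite subr0 => /eqP; rewrite subr_eq => /eqP ->; rewrite addr_ge0 // mulr_ge0 // df0.
Qed.

(* [N] stands for [p e^x + (1 - p) e^-x], the moment generating function of a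
   sign. Its logarithmic derivative [y = N' / N] has [y' = 1 - y ^ 2 <= 1]. *)
Section HyperbolicBound.
Context {R : realType} (N N' : R -> R).
Hypothesis N_gt0 : forall x, 0 < N x.
Hypothesis dN : forall x : R, is_derive x 1 N (N' x).
Hypothesis dN' : forall x : R, is_derive x 1 N' (N x).
Hypothesis N0 : N 0 = 1.

(** The difference N'(0) + x - N'(x) / N(x) vanishes at 0 and has derivative (N' / N)^2. *)
Lemma hyperbolic_ratio_le x : 0 <= x -> N' x <= (N' 0 + x) * N x.
Proof.
move=> x0; rewrite -ler_pdivrMr // -subr_ge0.
apply: (@is_derive_ge0 _ (fun x => N' 0 + x - N' x * (N x)^-1)
  (fun x => (N' x / N x) ^+ 2)) => // {x x0} [x|x _|].
- have dV := is_deriveV (lt0r_neq0 (N_gt0 x)) (dN x).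
  apply: is_derive_eq; rewrite /GRing.scale /=.
  by field; exact: lt0r_neq0.
- exact: sqr_ge0.
- by rewrite N0 divr1 addr0 subrr.
Qed.

(** With E the inverse of the claimed bound, 1 - N E vanishes at 0, and the ratio bound makes its
    derivative nonnegative. *)
Lemma hyperbolic_le_expR c : 0 <= c -> N c <= expR (N' 0 * c + c ^+ 2 / 2).
Proof.
move=> c0.
pose E x := expR (- (N' 0 * x + x ^+ 2 / 2)).
have dE (x : R) : is_derive x 1 E (- (N' 0 + x) * E x).
  by apply: is_derive_eq; rewrite /E /GRing.scale /=; field.
have E0 : E 0 = 1 by rewrite /E mulr0 expr0n /= mul0r addr0 oppr0 expR0.
have E_ge0 x : 0 <= E x by exact: expR_ge0.
have <- : (E c)^-1 = expR (N' 0 * c + c ^+ 2 / 2) by rewrite /E expRN invrK.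
have Ec : 0 < E c by exact: expR_gt0.
(* From here only the differential equation, the value at 0 and the sign of [E] are known. *)
move: (E) dE E0 E_ge0 Ec => {}E dE E0 E_ge0 Ec.
rewrite -[leRHS]mul1r ler_pdivlMr // -subr_ge0.
apply: (@is_derive_ge0 _ (fun x => 1 - N x * E x)
  (fun x => ((N' 0 + x) * N x - N' x) * E x)) => //.
- by move=> x; apply: is_derive_eq; rewrite /GRing.scale /=; ring.
- by move=> x x0; rewrite mulr_ge0 // subr_ge0 hyperbolic_ratio_le.
- by rewrite N0 E0 mulr1 subrr.
Qed.

End HyperbolicBound.

Lemma two_point_mgf_le {R : realType} (p q c : R) :
  0 <= p -> 0 <= q -> p + q = 1 -> 0 <= c ->
  p * expR c + q * expR (- c) <= expR ((p - q) * c + c ^+ 2 / 2).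
Proof.
move=> p0 q0 pq1 c0.
pose N x := p * expR x + q * expR (- x).
pose N' x := p * expR x - q * expR (- x).
have -> : p - q = N' 0 by rewrite /N' oppr0 expR0 !mulr1.
apply: (@hyperbolic_le_expR _ N N') => // [x|x|x|].
- have [e1 e2] := (expR_gt0 x, expR_gt0 (- x)).
  have [p0'|pn0] := eqVneq p 0.
    by rewrite /N -[q]add0r -p0' pq1 p0' mul0r add0r mul1r.
  rewrite /N ltr_pwDl //; first by rewrite mulr_gt0 // lt_neqAle eq_sym pn0.
  by rewrite mulr_ge0 // ltW.
- by apply: is_derive_eq; rewrite /N' /GRing.scale /=; ring.
- by apply: is_derive_eq; rewrite /N /GRing.scale /=; ring.
- by rewrite /N oppr0 expR0 !mulr1.
Qed.

(** Convexity of the exponential, with [x] written as a convex combination of [c] and [- c]. *)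
Lemma expR_le_chord {R : realType} (c x : R) : 0 < c -> `|x| <= c ->
  expR x <= (c + x) / (2 * c) * expR c + (c - x) / (2 * c) * expR (- c).
Proof.
move=> c0; rewrite ler_norml => /andP[xl xr].
have c20 : 0 < 2 * c by rewrite mulr_gt0.
have t0 : 0 <= (c + x) / (2 * c) by rewrite divr_ge0 ?(ltW c20) //; lra.
have t1 : (c + x) / (2 * c) <= 1 by rewrite ler_pdivrMr //; lra.
have := convex_expR (Itv01 t0 t1) c (- c).
rewrite !convRE /unstable.onem /=.
have -> : (c + x) / (2 * c) * c + (1 - (c + x) / (2 * c)) * - c = x.
  by field; rewrite lt0r_neq0.
suff -> : (1 - (c + x) / (2 * c)) = (c - x) / (2 * c) by [].
by field; rewrite lt0r_neq0.
Qed.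

(** Replacing each exponential by its chord reduces the claim to the two-point law on [c] and [- c]
    with the same mean. *)
Lemma hoeffding {R : realType} (X : finType) (p x : X -> R) (c : R) :
  (forall i, 0 <= p i) -> \sum_i p i = 1 -> 0 <= c ->
  (forall i, `|x i| <= c) ->
  \sum_i p i * expR (x i) <= expR (\sum_i p i * x i + c ^+ 2 / 2).
Proof.
(* The case c = 0 is treated apart because the chord divides by 2 c. *)
move=> p0 p1; rewrite le_eqVlt => /predU1P[<-|c0] xc.
  have x0 i : x i = 0 by apply/eqP; rewrite -normr_le0 xc.
  under eq_bigr do rewrite x0 expR0 mulr1.
  under [X in expR (X + _)]eq_bigr do rewrite x0 mulr0.
  by rewrite p1 big1 // expr0n /= mul0r addr0 expR0.
have c20 : 0 < 2 * c by rewrite mulr_gt0.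
set m := \sum_i p i * x i.
have sumpc : \sum_i p i * c = c by rewrite -big_distrl /= p1 mul1r.
have ml : - c <= m.
  rewrite -sumpc -sumrN; apply: ler_sum => i _.
  by rewrite -mulrN ler_wpM2l //; have := xc i; rewrite ler_norml => /andP[].
have mr : m <= c.
  rewrite -sumpc; apply: ler_sum => i _.
  by rewrite ler_wpM2l //; have := xc i; rewrite ler_norml => /andP[].
have := @two_point_mgf_le R ((c + m) / (2 * c)) ((c - m) / (2 * c)) c.
have -> : (c + m) / (2 * c) - (c - m) / (2 * c) = m / c.
  by field; rewrite lt0r_neq0.
rewrite divfK ?lt0r_neq0 // => H; apply: le_trans (H _ _ _ (ltW c0)); last first.
- by field; rewrite lt0r_neq0.
- by rewrite divr_ge0 ?(ltW c20) //; lra.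
- by rewrite divr_ge0 ?(ltW c20) //; lra.
apply: (@le_trans _ _ (\sum_i p i *
    ((c + x i) / (2 * c) * expR c + (c - x i) / (2 * c) * expR (- c)))).
  by apply: ler_sum => i _; rewrite ler_wpM2l // expR_le_chord.
rewrite le_eqVlt; apply/orP; left; apply/eqP.
have -> : c + m = \sum_i p i * (c + x i).
  by rewrite -[in LHS]sumpc -big_split /=; apply: eq_bigr => i _; rewrite mulrDr.
have -> : c - m = \sum_i p i * (c - x i).
  by rewrite -[in LHS]sumpc -sumrB; apply: eq_bigr => i _; rewrite mulrBr.
rewrite !big_distrl -big_split /=; apply: eq_bigr => i _; ring.
Qed.

(** * Regression over a ball *)

Section WeightedCauchySchwarz.
Context {R : realType} {X : finType} (p : X -> R).
Hypothesis p0 : forall x, 0 <= p x.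

(** The nonnegative sum of p (c f - b g)^2 equals c (a c - b^2); divide by c. *)
Lemma weighted_cauchy_schwarz (f g : X -> R) :
  (\sum_x p x * (f x * g x)) ^+ 2 <=
  (\sum_x p x * f x ^+ 2) * (\sum_x p x * g x ^+ 2).
Proof.
set b := \sum_x _; set a := \sum_x p x * f x ^+ 2; set c := \sum_x _.
have pg0 x : 0 <= p x * g x ^+ 2 by rewrite mulr_ge0 ?sqr_ge0.
have c0 : 0 <= c by exact: sumr_ge0.
(* If c = 0, every term of c vanishes, and with it every term of b. *)
have [c_eq0|cn0] := eqVneq c 0.
  rewrite c_eq0 mulr0 (_ : b = 0) ?expr0n // /b big1 // => x _.
  have /eqP : p x * g x ^+ 2 = 0 by exact: (psumr_eq0P (fun x _ => pg0 x) c_eq0).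
  rewrite mulf_eq0 sqrf_eq0 => /orP[/eqP->|/eqP->]; first by rewrite mul0r.
  by rewrite !mulr0.
have : 0 <= \sum_x p x * (c * f x - b * g x) ^+ 2.
  by apply: sumr_ge0 => x _; rewrite mulr_ge0 ?sqr_ge0.
have E (y w : R) : \sum_x p x * (y * f x - w * g x) ^+ 2 =
    y ^+ 2 * a - 2 * y * w * b + w ^+ 2 * c.
  rewrite /a /b /c !big_distrr -sumrB -big_split /=.
  by apply: eq_bigr => x _; ring.
have -> : \sum_x p x * (c * f x - b * g x) ^+ 2 = c * (a * c - b ^+ 2).
  by rewrite E; ring.
by rewrite pmulr_rge0 ?subr_ge0 // lt_neqAle eq_sym cn0.
Qed.

Lemma weighted_mean_le_sqrt (f : X -> R) : \sum_x p x = 1 ->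
  `|\sum_x p x * f x| <= Num.sqrt (\sum_x p x * f x ^+ 2).
Proof.
move=> p1; rewrite -sqrtr_sqr ler_wsqrtr //.
have := weighted_cauchy_schwarz f (fun=> 1).
under eq_bigr do rewrite mulr1.
under [X in _ * X]eq_bigr do rewrite expr1n mulr1.
by rewrite p1 mulr1.
Qed.

End WeightedCauchySchwarz.

Section DotProduct.
Context {R : realType} {d : nat}.
Implicit Types u v w : 'cV[R]_d.

Lemma dotvE u v : dotv u v = \sum_i u i 0 * v i 0.
Proof. by rewrite /dotv mxE; apply: eq_bigr => i _; rewrite mxE. Qed.

Lemma dotvC u v : dotv u v = dotv v u.
Proof. by rewrite !dotvE; apply: eq_bigr => i _; rewrite mulrC. Qed.

Lemma dotvDl u v w : dotv (u + v) w = dotv u w + dotv v w.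
Proof.
by rewrite !dotvE -big_split; apply: eq_bigr => i _; rewrite mxE mulrDl.
Qed.

Lemma dotvZl a u v : dotv (a *: u) v = a * dotv u v.
Proof. by rewrite !dotvE big_distrr /=; apply: eq_bigr => i _; rewrite mxE mulrA. Qed.

Lemma dotvNl u v : dotv (- u) v = - dotv u v.
Proof. by rewrite -scaleN1r dotvZl mulN1r. Qed.

Lemma dotv0l v : dotv 0 v = 0.
Proof. by rewrite -(scale0r v) dotvZl mul0r. Qed.

Lemma dotvv_ge0 u : 0 <= dotv u u.
Proof. by rewrite dotvE; apply: sumr_ge0 => i _; rewrite -expr2 sqr_ge0. Qed.

Lemma norm2_ge0 u : 0 <= norm2 u.
Proof. exact: sqrtr_ge0. Qed.

Lemma dotv_norm2 u v : `|dotv u v| <= norm2 u * norm2 v.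
Proof.
rewrite /norm2 -sqrtrM ?dotvv_ge0 // -sqrtr_sqr ler_wsqrtr //.
have := @weighted_cauchy_schwarz R _ (fun=> 1) (fun=> ler01)
  (fun i => u i 0) (fun i => v i 0).
rewrite !dotvE; under eq_bigr do rewrite mul1r.
under [X in X * _]eq_bigr do rewrite mul1r expr2.
by under [X in _ * X]eq_bigr do rewrite mul1r expr2.
Qed.

Lemma norm2_leP u (W : R) : 0 <= W -> (norm2 u <= W) = (dotv u u <= W ^+ 2).
Proof.
move=> W0; rewrite -[dotv u u]sqr_sqrtr ?dotvv_ge0 // -/(norm2 u).
by rewrite ler_pXn2r ?nnegrE ?norm2_ge0.
Qed.

Lemma norm2_segment u v (W s : R) : norm2 u <= W -> norm2 v <= W ->
  0 <= s -> s <= 1 -> norm2 (u + s *: (v - u)) <= W.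
Proof.
move=> uW vW s0 s1; have W0 := le_trans (norm2_ge0 u) uW.
have uv : dotv u v <= W ^+ 2.
  apply: le_trans (ler_norm _) _; apply: le_trans (dotv_norm2 u v) _.
  by rewrite expr2 ler_pM ?norm2_ge0.
move: uW vW; rewrite !norm2_leP // => uW vW.
have -> : u + s *: (v - u) = (1 - s) *: u + s *: v.
  by rewrite scalerBr scalerBl scale1r addrA addrAC.
rewrite dotvDl !dotvZl ![dotv _ (_ + _)]dotvC !dotvDl !dotvZl (dotvC v u).
have t0 : 0 <= 1 - s by rewrite subr_ge0.
have -> : W ^+ 2 = (1 - s) * ((1 - s) * W ^+ 2 + s * W ^+ 2) +
  s * ((1 - s) * W ^+ 2 + s * W ^+ 2) by ring.
by rewrite lerD // ler_wpM2l // lerD // ler_wpM2l.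
Qed.

End DotProduct.

(** * First-order optimality over the ball and change of measure by the relative condition number *)

Section Regression.
Context {R : realType} {S A : finType} (M : cmdp R S A).
Context {d : nat} (phi : S * A -> 'cV[R]_d).
Implicit Types (nu : S * A -> R) (w theta v : 'cV[R]_d).

Lemma regr_error_ge0 x nu w theta : (forall z, 0 <= nu z) ->
  0 <= regr_error M phi x nu w theta.
Proof. by move=> nu0; apply: sumr_ge0 => z _; rewrite mulr_ge0 ?sqr_ge0. Qed.

(* First-order optimality over the convex ball. *)
Lemma regr_argmin_gap (W : R) x nu theta ws w :
  is_regr_argmin M phi W x nu theta ws -> norm2 w <= W ->
  \sum_z nu z * dotv (ws - w) (phi z) ^+ 2 <=
  regr_error M phi x nu w theta - regr_error M phi x nu ws theta.
Proof.
move=> [wsW wsmin] wW.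
pose g z := Q M (loglinear phi theta) x z - dotv ws (phi z).
pose f z := dotv (w - ws) (phi z).
pose a := \sum_z nu z * f z ^+ 2; pose b := \sum_z nu z * (g z * f z).
have errE s : regr_error M phi x nu (ws + s *: (w - ws)) theta =
    regr_error M phi x nu ws theta - 2 * s * b + s ^+ 2 * a.
  rewrite /regr_error /a /b !big_distrr -sumrB -big_split /=.
  by apply: eq_bigr => z _; rewrite dotvDl dotvZl /g /f; ring.
(* Minimality of [ws] tested along the segment to [w], which stays in the ball. *)
have step s : 0 <= s -> s <= 1 -> 0 <= - 2 * s * b + s ^+ 2 * a.
  move=> s0 s1; have := wsmin _ (norm2_segment wsW wW s0 s1).
  by rewrite errE; lra.
(* The first-order condition. If b > 0, the test at s = 1 gives 2 b <= a, so s = b / a is admissible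
   and yields the negative value - b^2 / a. *)
have b0 : b <= 0.
  rewrite leNgt; apply/negP => b0.
  have ab : 2 * b <= a by have := step 1 ler01 (lexx 1); lra.
  have a0 : 0 < a by lra.
  have s0 : 0 <= b / a by rewrite divr_ge0 // ltW.
  have s1 : b / a <= 1 by rewrite ler_pdivrMr // mul1r; lra.
  have := step _ s0 s1.
  have -> : - 2 * (b / a) * b + (b / a) ^+ 2 * a = - (b ^+ 2 / a).
    by field; exact: lt0r_neq0.
  by rewrite oppr_ge0 leNgt divr_gt0 // exprn_gt0.
have -> : \sum_z nu z * dotv (ws - w) (phi z) ^+ 2 = a.
  by apply: eq_bigr => z _; rewrite /f -(opprB w) dotvNl sqrrN.
have := errE 1; rewrite scale1r addrCA subrr addr0 => ->; lra.
Qed.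

Lemma quad_form_cov nu v :
  quad_form (feature_cov phi nu) v = \sum_z nu z * dotv v (phi z) ^+ 2.
Proof.
rewrite /quad_form /feature_cov mulmx_sumr mulmx_suml summxE.
apply: eq_bigr => z _; rewrite -scalemxAr -scalemxAl mxE; congr (_ * _).
rewrite mulmxA -(mulmxA (v^T *m phi z)) mxE big_ord1 expr2; congr (_ * _).
by rewrite dotvC.
Qed.

(** The vector 0 contributes the ratio 0 / 0 = 0 to the supremum. *)
Lemma rel_cond_number_ge0 nus nu0 : (0 <= rel_cond_number phi nus nu0)%E.
Proof.
apply: ereal_sup_ubound; exists 0 => //; rewrite /quad_ratio !quad_form_cov.
rewrite !big1 ?eqxx // => z _; by rewrite dotv0l expr0n mulr0.
Qed.

Lemma rel_cond_numberP nus nu0 v :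
  (forall z, 0 <= nu0 z) -> (rel_cond_number phi nus nu0 < +oo)%E ->
  \sum_z nus z * dotv v (phi z) ^+ 2 <=
  fine (rel_cond_number phi nus nu0) * \sum_z nu0 z * dotv v (phi z) ^+ 2.
Proof.
move=> nu00 kfin; rewrite -!quad_form_cov.
set k := rel_cond_number _ _ _.
have kE : k = (fine k)%:E.
  by rewrite fineK // ge0_fin_numE // rel_cond_number_ge0.
have : (quad_ratio (quad_form (feature_cov phi nus) v)
                   (quad_form (feature_cov phi nu0) v) <= (fine k)%:E)%E.
  by rewrite -kE; apply: ereal_sup_ubound; exists v.
(* A vanishing denominator forces a vanishing numerator, since otherwise the ratio would be
   infinite. *)
rewrite /quad_ratio; case: eqP => [->|/eqP yn0].
  by case: eqP => [-> _|_]; rewrite ?mulr0 // leye_eq.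
rewrite lee_fin ler_pdivrMr // lt_neqAle eq_sym yn0 quad_form_cov.
by apply: sumr_ge0 => z _; rewrite mulr_ge0 ?sqr_ge0.
Qed.

End Regression.

(** * Log-linear policies *)

Section LogLinearPolicy.
Context {R : realType} {S A : finType} {d : nat} (phi : S * A -> 'cV[R]_d).
Implicit Types (theta u w : 'cV[R]_d).
Hypothesis A_gt0 : (0 < #|A|)%N.

Lemma softmax_denom_gt0 theta s : 0 < \sum_a expR (dotv theta (phi (s, a))).
Proof.
move/card_gt0P: A_gt0 => [a0 _]; rewrite (bigD1 a0) //= ltr_pwDl ?expR_gt0 //.
by apply: sumr_ge0 => a _; exact: expR_ge0.
Qed.

Lemma loglinear_gt0 theta s a : 0 < loglinear phi theta s a.
Proof. by rewrite divr_gt0 ?expR_gt0 ?softmax_denom_gt0. Qed.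

Lemma loglinear_policy theta : is_policy (loglinear phi theta).
Proof.
move=> s; split=> [a|]; first exact: ltW (loglinear_gt0 _ _ _).
by rewrite -big_distrl /= divff // lt0r_neq0 // softmax_denom_gt0.
Qed.

Lemma loglinear0 s a : loglinear phi 0 s a = #|A|%:R^-1.
Proof.
rewrite /loglinear dotv0l expR0 mul1r; congr (_^-1).
under eq_bigr do rewrite dotv0l expR0.
by rewrite sumr_const.
Qed.

Lemma softmax_mgf_gt0 theta (f : A -> R) s :
  0 < \sum_a loglinear phi theta s a * expR (f a).
Proof.
have pf a : 0 < loglinear phi theta s a * expR (f a).
  by rewrite mulr_gt0 ?expR_gt0 ?loglinear_gt0.
move/card_gt0P: A_gt0 => [a0 _]; rewrite (bigD1 a0) //= ltr_pwDl //.
by apply: sumr_ge0 => a _; exact: ltW.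
Qed.

(** Adding [u] tilts the policy by the exponential of its score and renormalizes by the moment
    generating function of that score. *)
Lemma ln_loglinearD theta u s a :
  ln (loglinear phi (theta + u) s a) = ln (loglinear phi theta s a) +
    dotv u (phi (s, a)) -
    ln (\sum_a' loglinear phi theta s a' * expR (dotv u (phi (s, a')))).
Proof.
have Z0 := softmax_denom_gt0 theta s.
set Y := \sum_a' _.
have Y0 : 0 < Y by exact: softmax_mgf_gt0.
have -> : loglinear phi (theta + u) s a =
    loglinear phi theta s a * expR (dotv u (phi (s, a))) / Y.
  have ZY : \sum_a' expR (dotv (theta + u) (phi (s, a'))) =
      (\sum_a' expR (dotv theta (phi (s, a')))) * Y.
    rewrite /Y big_distrr /=; apply: eq_bigr => a' _.
    by rewrite dotvDl expRD /loglinear; field; exact: lt0r_neq0.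
  rewrite {1}/loglinear ZY dotvDl expRD /loglinear; field.
  by rewrite !lt0r_neq0.
have p0 := loglinear_gt0 theta s a.
have e0 := expR_gt0 (dotv u (phi (s, a))).
by rewrite ln_div ?posrE ?(mulr_gt0 p0 e0) // lnM ?posrE // expRK.
Qed.

(* Smoothness of the log-partition function, through Hoeffding's lemma. *)
Lemma ln_loglinear_step theta u s a (c : R) : 0 <= c ->
  (forall z, `|dotv u (phi z)| <= c) ->
  dotv u (phi (s, a)) -
    \sum_a' loglinear phi theta s a' * dotv u (phi (s, a')) - c ^+ 2 / 2 <=
  ln (loglinear phi (theta + u) s a) - ln (loglinear phi theta s a).
Proof.
move=> c0 uc; rewrite ln_loglinearD.
have hpi := loglinear_policy theta s.
have := @hoeffding R A (loglinear phi theta s) (fun a => dotv u (phi (s, a))) c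
  hpi.1 hpi.2 c0 (fun a => uc (s, a)).
set Y := \sum_a' _ * expR _; set m := \sum_a' _ * _.
have Y0 : 0 < Y by exact: softmax_mgf_gt0.
move=> Ym; have : ln Y <= m + c ^+ 2 / 2.
  by rewrite -(expRK (m + _)) ler_ln ?posrE ?expR_gt0.
by lra.
Qed.

End LogLinearPolicy.

(** * One policy update measured against the optimal policy *)

Section PolicyImprovement.
Context {R : realType} {S A : finType} (M : cmdp R S A).
Context {d : nat} (phi : S * A -> 'cV[R]_d) (rho : S -> R).
Context (pistar : S -> A -> R).
Hypothesis A_gt0 : (0 < #|A|)%N.
Hypothesis hrho : is_dist rho.
Hypothesis hstar : is_policy pistar.
Local Notation gamma := (disc M).
Local Notation dstar := (visit_s M pistar rho).
Implicit Types (theta u w : 'cV[R]_d) (x : signal).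

Lemma onem_disc_gt0 : 0 < 1 - gamma.
Proof. by rewrite subr_gt0 disc_lt1. Qed.

Lemma dstar_dist : is_dist dstar.
Proof.
have g1 := onem_disc_gt0; split=> [s|].
  by rewrite visit_sE // mulr_ge0 ?socc_ge0 // ltW.
under eq_bigr do rewrite visit_sE //.
by rewrite -big_distrr /= socc_mass // divff // lt0r_neq0.
Qed.

(** Linear in [f], so that Q-functions, their linear fits and the residuals can be compared term by
    term. *)
Definition policy_gap theta (f : S * A -> R) : R :=
  \sum_s dstar s *
    (\sum_a pistar s a * f (s, a) - \sum_a loglinear phi theta s a * f (s, a)).

Lemma policy_gapD theta (f g : S * A -> R) :
  policy_gap theta (fun z => f z + g z) = policy_gap theta f + policy_gap theta g.
Proof.
rewrite /policy_gap -big_split /=; apply: eq_bigr => s _.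
under eq_bigr do rewrite mulrDr.
under [X in _ - X]eq_bigr do rewrite mulrDr.
by rewrite !big_split /=; ring.
Qed.

Lemma policy_gapZ theta (k : R) (f : S * A -> R) :
  policy_gap theta (fun z => k * f z) = k * policy_gap theta f.
Proof.
rewrite /policy_gap big_distrr /=; apply: eq_bigr => s _.
rewrite [RHS]mulrCA; congr (_ * _); rewrite mulrBr !big_distrr /=; congr (_ - _);
  by apply: eq_bigr => a _; rewrite mulrCA.
Qed.

(** The performance difference lemma; the baseline V is the mean of Q under the current policy. *)
Lemma V_gap x theta :
  (1 - gamma) * (V M pistar x rho - V M (loglinear phi theta) x rho) =
  policy_gap theta (Q M (loglinear phi theta) x).
Proof.
have hpi := loglinear_policy phi A_gt0 theta.
rewrite -performance_difference // sum_pair big_distrr /=.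
apply: eq_bigr => s _; rewrite visit_sE // -mulrA; congr (_ * _).
under eq_bigr do rewrite occ_socc // -mulrA mulrBr.
rewrite -big_distrr sumrB /= -big_distrl /= (hstar s).2 mul1r.
by rewrite -Vs_Q.
Qed.

Lemma nu_star_sum (h : S * A -> R) :
  \sum_z nu_star M rho pistar z * h z =
  #|A|%:R^-1 * \sum_s dstar s * \sum_a h (s, a).
Proof.
rewrite sum_pair big_distrr /=; apply: eq_bigr => s _.
rewrite mulrA big_distrr /=; apply: eq_bigr => a _.
by rewrite /nu_star /= [dstar s * _]mulrC.
Qed.

Lemma nu_star_ge0 z : 0 <= nu_star M rho pistar z.
Proof. by rewrite mulr_ge0 ?invr_ge0 ?ler0n // dstar_dist.1. Qed.

(** After Cauchy-Schwarz, each [pi s a] is at most 1, which is |A| times the uniform weight of nu*: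
    the origin of the factor |A|. *)
Lemma policy_mean_le (pi : S -> A -> R) (h : S * A -> R) : is_policy pi ->
  `|\sum_s dstar s * \sum_a pi s a * h (s, a)| <=
  Num.sqrt (#|A|%:R * \sum_z nu_star M rho pistar z * h z ^+ 2).
Proof.
move=> hpi; have hd := dstar_dist.
rewrite nu_star_sum mulrA divff ?mul1r; last by rewrite pnatr_eq0 -lt0n.
have := @weighted_mean_le_sqrt R _ (fun z => dstar z.1 * pi z.1 z.2) _ h _.
move=> /(_ (start_dist hpi hd).1 (start_dist hpi hd).2).
rewrite !sum_pair /=.
under eq_bigr => s _ do under eq_bigr => a _ do rewrite -mulrA.
under eq_bigr do rewrite -big_distrr /=.
move=> /le_trans; apply; rewrite ler_wsqrtr //; apply: ler_sum => s _.
rewrite big_distrr /=; apply: ler_sum => a _.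
rewrite -mulrA ler_wpM2l ?hd.1 // ler_piMl ?sqr_ge0 //.
exact: dist_le1.
Qed.

Lemma policy_gap_le theta (h : S * A -> R) : policy_gap theta h <=
  2 * Num.sqrt (#|A|%:R * \sum_z nu_star M rho pistar z * h z ^+ 2).
Proof.
rewrite /policy_gap; under eq_bigr do rewrite mulrBr.
rewrite sumrB.
have := policy_mean_le h hstar.
have := policy_mean_le h (loglinear_policy phi A_gt0 theta).
by rewrite !ler_norml => /andP[? ?] /andP[? ?]; lra.
Qed.

(* The relative entropy of the optimal policy, up to a constant. *)
Definition cross_entropy theta : R :=
  - \sum_s dstar s * \sum_a pistar s a * ln (loglinear phi theta s a).

Lemma cross_entropy_ge0 theta : 0 <= cross_entropy theta.
Proof.
rewrite oppr_ge0; apply: sumr_le0 => s _.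
rewrite mulr_ge0_le0 ?dstar_dist.1 //; apply: sumr_le0 => a _.
rewrite mulr_ge0_le0 ?(hstar s).1 // -ln1 ler_ln ?posrE ?loglinear_gt0 //.
exact/dist_le1/loglinear_policy.
Qed.

Lemma cross_entropy0 : cross_entropy 0 = ln #|A|%:R.
Proof.
rewrite /cross_entropy.
under eq_bigr do under eq_bigr do rewrite loglinear0 lnV ?posrE ?ltr0n //.
under eq_bigr do rewrite -big_distrl /= (hstar _).2 mul1r.
by rewrite -big_distrl /= dstar_dist.2 mul1r opprK.
Qed.

(** The mirror descent inequality: [ln_loglinear_step] averaged over [dstar] and [pistar]. *)
Lemma cross_entropy_step theta u (c : R) : 0 <= c ->
  (forall z, `|dotv u (phi z)| <= c) ->
  policy_gap theta (fun z => dotv u (phi z)) <=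
  cross_entropy theta - cross_entropy (theta + u) + c ^+ 2 / 2.
Proof.
move=> c0 uc; rewrite /cross_entropy.
set L := \sum_s _; set L' := \sum_s _.
suff : policy_gap theta (fun z => dotv u (phi z)) - c ^+ 2 / 2 <= L' - L by lra.
have -> : policy_gap theta (fun z => dotv u (phi z)) - c ^+ 2 / 2 =
    \sum_s dstar s * (\sum_a pistar s a * (dotv u (phi (s, a)) -
    \sum_a' loglinear phi theta s a' * dotv u (phi (s, a')) - c ^+ 2 / 2)).
  rewrite -[X in _ - X]mul1r -[X in _ - X * _]dstar_dist.2 big_distrl -sumrB.
  apply: eq_bigr => s _; rewrite -mulrBr; congr (_ * _).
  under [RHS]eq_bigr do rewrite !mulrBr.
  by rewrite !sumrB -!big_distrl /= (hstar s).2 !mul1r.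
rewrite -sumrB; apply: ler_sum => s _.
rewrite -mulrBr ler_wpM2l ?dstar_dist.1 // -sumrB; apply: ler_sum => a _.
by rewrite -mulrBr ler_wpM2l ?(hstar s).1 // ln_loglinear_step.
Qed.

(** The first root measures the exact minimizer under nu*, the second the excess of [w] over it
    under [nu], inflated by the change of measure. *)
Definition approx_error (kappa : R) (nu : S * A -> R) x theta w ws : R :=
  Num.sqrt (#|A|%:R * regr_error M phi x (nu_star M rho pistar) ws theta) +
  Num.sqrt (kappa * #|A|%:R / (1 - gamma) *
    (regr_error M phi x nu w theta - regr_error M phi x nu ws theta)).

Lemma regression_gap_le x (nu0 : S * A -> R) (W : R) theta w ws :
  is_dist nu0 ->
  (rel_cond_number phi (nu_star M rho pistar) nu0 < +oo)%E ->
  is_regr_argmin M phi W x (nu_t M phi nu0 theta) theta ws -> norm2 w <= W ->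
  policy_gap theta (fun z => Q M (loglinear phi theta) x z - dotv w (phi z)) <=
  2 * approx_error (fine (rel_cond_number phi (nu_star M rho pistar) nu0))
        (nu_t M phi nu0 theta) x theta w ws.
Proof.
move=> hnu0 kfin hws wW; set k := fine _; have g1 := onem_disc_gt0.
have hpi := loglinear_policy phi A_gt0 theta.
have -> : (fun z => Q M (loglinear phi theta) x z - dotv w (phi z)) =
    (fun z => (Q M (loglinear phi theta) x z - dotv ws (phi z)) +
              dotv (ws - w) (phi z)).
  by apply/funext => z; rewrite dotvDl dotvNl; ring.
rewrite policy_gapD mulrDr lerD ?policy_gap_le //.
apply: le_trans (policy_gap_le _ _) _; rewrite ler_wpM2l // ler_wsqrtr //.
rewrite [k * _]mulrC -!mulrA ler_wpM2l //.
have k0 : 0 <= k by rewrite fine_ge0 // rel_cond_number_ge0.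
(* Two changes of measure: kappa leads from nu* to [nu0], then [visit_sa_ge] from [nu0] to
   nu^(t). *)
apply: le_trans (rel_cond_numberP _ hnu0.1 kfin) _; rewrite -/k ler_wpM2l //.
rewrite mulrC ler_pdivlMr //.
apply: le_trans (regr_argmin_gap hws wW).
rewrite big_distrl /=; apply: ler_sum => z _; rewrite mulrAC.
by rewrite ler_wpM2r ?sqr_ge0 // mulrC visit_sa_ge.
Qed.

(** The step size eta / (1 - gamma) absorbs the factor 1 - gamma of [V_gap]; the residual bounds let
    the linear fits of [cross_entropy_step] stand for the Q-functions. *)
Lemma lagrangian_step theta (wr wg : 'cV[R]_d) (lambda eta W B dr dg : R) :
  0 <= eta -> 0 <= lambda -> (forall z, norm2 (phi z) <= B) ->
  norm2 wr <= W -> norm2 wg <= W -> 0 <= W ->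
  policy_gap theta (fun z => Q M (loglinear phi theta) Reward z - dotv wr (phi z))
    <= 2 * dr ->
  policy_gap theta (fun z => Q M (loglinear phi theta) Utility z - dotv wg (phi z))
    <= 2 * dg ->
  eta * ((V M pistar Reward rho - V M (loglinear phi theta) Reward rho) +
    lambda * (V M pistar Utility rho - V M (loglinear phi theta) Utility rho)) <=
  cross_entropy theta -
    cross_entropy (theta + (eta / (1 - gamma)) *: (wr + lambda *: wg)) +
  (eta / (1 - gamma) * (W * B * (1 + lambda))) ^+ 2 / 2 +
  2 * eta / (1 - gamma) * (dr + lambda * dg).
Proof.
move=> eta0 l0 phiB wrW wgW W0 hr hg; have g1 := onem_disc_gt0.
set k := eta / (1 - gamma); set u := k *: _; set c := k * _.
have k0 : 0 <= k by rewrite divr_ge0 // ltW.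
have wB w z : norm2 w <= W -> `|dotv w (phi z)| <= W * B.
  move=> wW; apply: le_trans (dotv_norm2 _ _) _.
  by rewrite ler_pM ?norm2_ge0.
have uc z : `|dotv u (phi z)| <= c.
  rewrite dotvZl dotvDl dotvZl normrM (ger0_norm k0) ler_wpM2l //.
  apply: le_trans (ler_normD _ _) _; rewrite normrM (ger0_norm l0) mulrDr mulr1.
  by rewrite lerD ?wB // mulrC ler_wpM2r ?wB.
(* A state-action pair is needed to see that [c] is nonnegative; one exists because [dstar] has mass
   one. *)
have [z _|Z0] := pickP (fun _ : S * A => true); last first.
  move: (dstar_dist.2); rewrite big_pred0 => [/esym/eqP|s]; first by rewrite oner_eq0.
  by move/card_gt0P: A_gt0 => [a _]; have := Z0 (s, a).
have c0 : 0 <= c by exact: le_trans (uc z).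
have := cross_entropy_step theta c0 uc.
have -> : policy_gap theta (fun z => dotv u (phi z)) =
    k * (policy_gap theta (fun z => dotv wr (phi z)) +
         lambda * policy_gap theta (fun z => dotv wg (phi z))).
  rewrite -policy_gapZ -policy_gapD -policy_gapZ; congr (policy_gap _ _).
  by apply/funext => y; rewrite dotvZl dotvDl dotvZl.
have gapB x w : policy_gap theta
    (fun z => Q M (loglinear phi theta) x z - dotv w (phi z)) =
    (1 - gamma) * (V M pistar x rho - V M (loglinear phi theta) x rho) -
    policy_gap theta (fun z => dotv w (phi z)).
  rewrite V_gap -mulN1r -policy_gapZ -policy_gapD; congr (policy_gap _ _).
  by apply/funext => y; rewrite mulN1r.
move: hr hg; rewrite !gapB.
set Gr := policy_gap _ _; set Gg := policy_gap _ _.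
set vr := V _ _ _ _ - V _ _ _ _; set vg := V _ _ Utility _ - _.
move=> hr hg hD.
have : k * ((1 - gamma) * vr - Gr + lambda * ((1 - gamma) * vg - Gg)) <=
    k * (2 * dr + lambda * (2 * dg)).
  by rewrite ler_wpM2l // lerD // ler_wpM2l.
have -> : eta * (vr + lambda * vg) = k * ((1 - gamma) * vr + lambda * ((1 - gamma) * vg)).
  by rewrite /k; field; exact: lt0r_neq0.
have -> : 2 * eta / (1 - gamma) = 2 * k by rewrite /k mulrA.
by move: hD; nra.
Qed.

End PolicyImprovement.

(** * The primal-dual run *)

Section ProjectionOnSegment.
Context {R : realType} (L : R).
Hypothesis L0 : 0 <= L.

(** Minimality is tested at the clamped point. The closed form also serves to show that the
    multipliers are measurable. *)
Lemma is_projection_segment (x y : R) :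
  is_projection `[0, L] x y -> y = Num.min (Num.max x 0) L.
Proof.
rewrite /is_projection /= in_itv /= => -[/andP[y0 yL]].
move=> /(_ (Num.min (Num.max x 0) L)); rewrite /= in_itv /=.
have -> : 0 <= Num.min (Num.max x 0) L <= L.
  by rewrite le_min L0 le_max lexx orbT ge_min lexx orbT.
move=> /(_ isT); have [x0|x0] := ltP x 0.
  rewrite (min_idPl L0) subr0 (ltr0_norm x0) ler_norml => /andP[]; lra.
have [xL|xL] := ltP x L.
  by rewrite subrr normr0 normr_le0 subr_eq0 => /eqP ->.
have d0 : 0 <= x - L by lra.
rewrite (ger0_norm d0) ler_norml => /andP[]; lra.
Qed.

Lemma is_projection_sqr (x y l : R) : is_projection `[0, L] x y ->
  0 <= l -> l <= L -> (y - l) ^+ 2 <= (x - l) ^+ 2.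
Proof.
move=> /is_projection_segment -> l0 lL.
by have [x0|x0] := ltP x 0; [rewrite (min_idPl L0)|have [xL|xL] := ltP x L]; nra.
Qed.

End ProjectionOnSegment.

(** Used with i = 1 / (1 - gamma), j = 1 / xi, L = log |A| and K = (W B)^2, so that the right end of
    the multiplier interval is 2 i j. *)
Lemma reward_constant_le {R : realFieldType} (i j L K : R) :
  1 <= i -> 0 < j -> 1 <= i * j -> 0 <= L -> 0 <= K ->
  L + i ^+ 2 * (K * (1 + 2 * (i * j)) ^+ 2 + 1) / 2 <=
  (1 + L + 5 * K * j ^+ 2) * i ^+ 5.
Proof.
move=> i1 j0 ij1 L0 K0.
have i2 : 1 <= i ^+ 2 by rewrite exprn_ege1.
have i3 : i ^+ 2 <= i ^+ 5 by apply: ler_weXn2l.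
have i4 : i ^+ 4 <= i ^+ 5 by apply: ler_weXn2l.
have h1 : L <= L * i ^+ 5 by rewrite ler_peMr // exprn_ege1.
(* Half of this 10 is the 5 of the reward constant. *)
have h2 : (1 + 2 * (i * j)) ^+ 2 <= 10 * (i * j) ^+ 2.
  have : 0 <= (i * j - 1) * (6 * (i * j) + 2) by apply: mulr_ge0; lra.
  by lra.
have h3 : i ^+ 2 * (K * (1 + 2 * (i * j)) ^+ 2) <= i ^+ 2 * (K * (10 * (i * j) ^+ 2)).
  by apply: ler_wpM2l; [rewrite exprn_ge0 // (le_trans ler01)|exact: ler_wpM2l].
have h4 : K * j ^+ 2 * i ^+ 4 <= K * j ^+ 2 * i ^+ 5.
  by rewrite ler_wpM2l // mulr_ge0 // sqr_ge0.
have E : i ^+ 2 * (K * (10 * (i * j) ^+ 2)) = 10 * (K * j ^+ 2 * i ^+ 4) by ring.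
by lra.
Qed.

(** Same reading of the variables. The extra square is l^2 / 2 at l = 2 i j, and the last factor i j
    is the coefficient that the violation keeps after the duality bound. *)
Lemma utility_constant_le {R : realFieldType} (i j L K : R) :
  1 <= i -> 0 < j -> 1 <= i * j -> 0 <= L -> 0 <= K ->
  L + (2 * (i * j)) ^+ 2 / 2 + i ^+ 2 * (K * (1 + 2 * (i * j)) ^+ 2 + 1) / 2 <=
  ((1 + L + K) * j^-1 + (2 + 4 * K) * j) * i ^+ 4 * (i * j).
Proof.
move=> i1 j0 ij1 L0 K0.
have i0 : 0 < i by rewrite (lt_le_trans ltr01).
have h2 : (1 + 2 * (i * j)) ^+ 2 <= 2 + 8 * (i * j) ^+ 2.
  by have := sqr_ge0 (1 - 2 * (i * j)); lra.
have h3 : i ^+ 2 * (K * (1 + 2 * (i * j)) ^+ 2) <= i ^+ 2 * (K * (2 + 8 * (i * j) ^+ 2)).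
  by apply: ler_wpM2l; [rewrite exprn_ge0 // ltW|exact: ler_wpM2l].
have -> : ((1 + L + K) * j^-1 + (2 + 4 * K) * j) * i ^+ 4 * (i * j) =
    (1 + L + K) * i ^+ 5 + (2 + 4 * K) * j ^+ 2 * i ^+ 5.
  by field; exact: lt0r_neq0.
have i2 : i ^+ 2 <= i ^+ 5 by apply: ler_weXn2l.
have i4 : i ^+ 4 <= i ^+ 5 by apply: ler_weXn2l.
have i5 : 1 <= i ^+ 5 by rewrite exprn_ege1.
have h1 : L <= L * i ^+ 5 by rewrite ler_peMr.
have h4 : K * j ^+ 2 * i ^+ 4 <= K * j ^+ 2 * i ^+ 5.
  by rewrite ler_wpM2l // mulr_ge0 // sqr_ge0.
have h5 : j ^+ 2 * i ^+ 2 <= j ^+ 2 * i ^+ 5 by rewrite ler_wpM2l // sqr_ge0.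
have h6 : K * i ^+ 2 <= K * i ^+ 5 by rewrite ler_wpM2l.
have E : i ^+ 2 * (K * (2 + 8 * (i * j) ^+ 2)) = 2 * (K * i ^+ 2) + 8 * (K * j ^+ 2 * i ^+ 4).
  by ring.
have E2 : (2 * (i * j)) ^+ 2 = 4 * (j ^+ 2 * i ^+ 2) by ring.
by lra.
Qed.

(** The linear arithmetic of one step, and below that of the telescoping, over bare variables free
    of the terms of the model. *)
Lemma step_arith {R : realFieldType} (X q r s y z z' u u' m m' g c c' : R) :
  m' <= m - 2 * r + 2 * s + g -> X <= c - c' + y + u -> - r <= q ->
  y + z' / 2 <= z -> u <= u' -> g <= z' ->
  X - q - s <= c - c' + (m - m') / 2 + z + u'.
Proof. lra. Qed.

Lemma telescope_arith {R : realFieldType} (X Y a c c' m m' m'' k k' u u' : R) :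
  X <= a - c + (m - m') / 2 + k + u -> Y <= c - c' + (m' - m'') / 2 + k' + u' ->
  X + Y <= a - c' + (m - m'') / 2 + (k + k') + (u + u').
Proof. lra. Qed.

(** * Regret of one realization of the run and its two consequences *)

Section PrimalDualRun.
Context {R : realType} {S A : finType} (M : cmdp R S A).
Context {d : nat} (phi : S * A -> 'cV[R]_d) (rho : S -> R).
Context (pistar : S -> A -> R) (xi W B : R) (T : nat).
Context (w : signal -> nat -> 'cV[R]_d) (theta : nat -> 'cV[R]_d).
Context (lambda : nat -> R) (delta : signal -> nat -> R).
Local Notation gamma := (disc M).
Local Notation b := (thr M).
Local Notation eta := (Num.sqrt (T%:R : R))^-1.
Local Notation Lambda := (2 / ((1 - gamma) * xi)).
Hypothesis A_gt0 : (0 < #|A|)%N.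
Hypothesis hrho : is_dist rho.
Hypothesis hslater : slater M rho xi.
Hypothesis hstar : is_optimal M rho pistar.
Hypothesis phiB : forall z, norm2 (phi z) <= B.
Hypothesis W0 : 0 <= W.
Hypothesis T0 : (0 < T)%N.
Hypothesis hrun : npg_pd_run M phi rho xi W eta eta w theta lambda.
Hypothesis delta_ge0 : forall x t, 0 <= delta x t.
Hypothesis hdelta : forall x t,
  policy_gap M phi rho pistar (theta t)
    (fun z => Q M (loglinear phi (theta t)) x z - dotv (w x t) (phi z)) <=
  2 * delta x t.

Local Notation Vt x t := (V M (loglinear phi (theta t)) x rho).
Local Notation Vstar x := (V M pistar x rho).

Let g1 : 0 < 1 - gamma := onem_disc_gt0 M.

Let xi0 : 0 < xi. Proof. by case: hslater. Qed.

Let L0 : 0 <= Lambda.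
Proof. by rewrite divr_ge0 // mulr_ge0 // ltW. Qed.

Let eta0 : 0 <= eta.
Proof. by rewrite invr_ge0 sqrtr_ge0. Qed.

Let hpi t : is_policy (loglinear phi (theta t)) := loglinear_policy phi A_gt0 (theta t).

Lemma run_lambda_bounds t : 0 <= lambda t <= Lambda.
Proof.
case: t => [|t]; first by rewrite (run_lambda0 hrun) lexx.
by case: (run_lambda hrun t) => /=; rewrite in_itv.
Qed.

Lemma utility_slack_sqr t : (Vt Utility t - b) ^+ 2 <= (1 - gamma)^-1 ^+ 2.
Proof.
have [v0 v1] := (V_ge0 M Utility (hpi t) hrho, V_le M Utility (hpi t) hrho).
have [b0 b1] := (thr_gt0 M, thr_le M).
have : 0 <= ((1 - gamma)^-1 - (Vt Utility t - b)) * ((1 - gamma)^-1 + (Vt Utility t - b)).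
  by rewrite mulr_ge0; lra.
by rewrite -subr_sqr subr_ge0.
Qed.

(** The slack is at most the utility value, because b > 0, and that value is at most 1 / (1 -
    gamma). *)
Lemma slater_le : xi * (1 - gamma) <= 1.
Proof.
case: hslater => _ [pibar [hbar]].
have v1 := V_le M Utility hbar hrho; have b0 := thr_gt0 M => xib.
by rewrite -ler_pdivlMr // mul1r; lra.
Qed.

(** Second-order cost of a step in units of eta^2: the Hoeffding term at the largest multiplier plus
    the squared dual gradient. *)
Let Kc : R := ((W * B * (1 + Lambda)) ^+ 2 + 1) / (2 * (1 - gamma) ^+ 2).

Lemma run_step (l : R) t : 0 <= l -> l <= Lambda ->
  eta * (Vstar Reward - Vt Reward t - l * (Vt Utility t - b)) <=
  cross_entropy M phi rho pistar (theta t) -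
  cross_entropy M phi rho pistar (theta t.+1) +
  ((lambda t - l) ^+ 2 - (lambda t.+1 - l) ^+ 2) / 2 + eta ^+ 2 * Kc +
  2 * eta / (1 - gamma) * (delta Reward t + Lambda * delta Utility t).
Proof.
move=> l0 lL; case: hstar => pstar gstar _.
have /andP[lt0 ltL] := run_lambda_bounds t.
have := lagrangian_step A_gt0 hrho pstar eta0 lt0 phiB
  (run_w hrun Reward t) (run_w hrun Utility t) W0 (hdelta Reward t) (hdelta Utility t).
rewrite -(run_theta hrun).
have := is_projection_sqr L0 (run_lambda hrun t) l0 lL.
have := utility_slack_sqr t.
set D := cross_entropy _ _ _ _ _; set D' := cross_entropy _ _ _ _ _.
set vr := Vstar Reward - _; set y := Vt Utility t; set e := eta.
set dr := delta Reward t; set dg := delta Utility t.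
set i := (1 - gamma)^-1 => ysq hdual hprim.
have e0 : 0 <= e by exact: eta0.
have i0 : 0 <= i by rewrite invr_ge0 ltW.
(* Feasibility of [pistar] replaces its utility by the threshold. *)
have h1 : e * lambda t * (b - y) <= e * lambda t * (Vstar Utility - y).
  by rewrite ler_wpM2l ?mulr_ge0 // lerD2r.
have h2 : (e / (1 - gamma) * (W * B * (1 + lambda t))) ^+ 2 / 2 + e ^+ 2 * i ^+ 2 / 2
    <= e ^+ 2 * Kc.
  have -> : e ^+ 2 * Kc = e ^+ 2 * i ^+ 2 * (W * B * (1 + Lambda)) ^+ 2 / 2 +
      e ^+ 2 * i ^+ 2 / 2.
    by rewrite /Kc /i; set Z := W * B * _; field; exact: lt0r_neq0.
  have hl : (1 + lambda t) ^+ 2 <= (1 + Lambda) ^+ 2.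
    by rewrite ler_pXn2r ?nnegrE ?lerD2l // addr_ge0.
  have E1 (l' : R) : (e / (1 - gamma) * (W * B * (1 + l'))) ^+ 2 / 2 =
      (e * i * W * B) ^+ 2 / 2 * (1 + l') ^+ 2 by rewrite -/i; ring.
  have E2 (l' : R) : e ^+ 2 * i ^+ 2 * (W * B * (1 + l')) ^+ 2 / 2 =
      (e * i * W * B) ^+ 2 / 2 * (1 + l') ^+ 2 by ring.
  rewrite lerD2r E1 E2; apply: ler_wpM2l hl.
  by rewrite mulr_ge0 ?sqr_ge0 ?invr_ge0.
have h3 : 2 * e / (1 - gamma) * (dr + lambda t * dg) <=
    2 * e / (1 - gamma) * (dr + Lambda * dg).
  apply: ler_wpM2l; first by rewrite mulr_ge0 // mulr_ge0.
  by rewrite lerD2l; apply: ler_wpM2r => //; exact: delta_ge0.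
have h4 : e ^+ 2 * (y - b) ^+ 2 <= e ^+ 2 * i ^+ 2 by rewrite ler_wpM2l ?sqr_ge0.
have sq : (lambda t - e * (y - b) - l) ^+ 2 = (lambda t - l) ^+ 2 -
    2 * (e * lambda t * (y - b)) + 2 * (e * l * (y - b)) + e ^+ 2 * (y - b) ^+ 2.
  by ring.
have -> : e * (vr - l * (y - b)) = e * (vr + lambda t * (Vstar Utility - y)) -
    e * lambda t * (Vstar Utility - y) - e * l * (y - b) by ring.
have h5 : e * lambda t * (b - y) = - (e * lambda t * (y - b)) by ring.
rewrite sq in hdual; rewrite h5 in h1.
exact: step_arith hdual hprim h1 h2 h3 h4.
Qed.

Lemma run_regret (l : R) : 0 <= l -> l <= Lambda ->
  T%:R^-1 * \sum_(t < T) (Vstar Reward - Vt Reward t - l * (Vt Utility t - b)) <=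
  eta * (ln #|A|%:R + l ^+ 2 / 2 + Kc) +
  2 / (1 - gamma) *
    (T%:R^-1 * \sum_(t < T) (delta Reward t + Lambda * delta Utility t)).
Proof.
move=> l0 lL; case: (hstar) => pstar _ _.
pose F t := Vstar Reward - Vt Reward t - l * (Vt Utility t - b).
pose G t := delta Reward t + Lambda * delta Utility t.
pose D t := cross_entropy M phi rho pistar (theta t).
have tele n : eta * \sum_(t < n) F t <= D 0%N - D n +
    ((lambda 0%N - l) ^+ 2 - (lambda n - l) ^+ 2) / 2 + n%:R * (eta ^+ 2 * Kc) +
    2 * eta / (1 - gamma) * \sum_(t < n) G t.
  elim: n => [|n IH]; first by rewrite !big_ord0 !subrr !mul0r !mulr0 !addr0.
  have -> : n.+1%:R * (eta ^+ 2 * Kc) = n%:R * (eta ^+ 2 * Kc) + eta ^+ 2 * Kc.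
    by rewrite -natr1 mulrDl mul1r.
  rewrite !big_ord_recr /= [eta * (_ + _)]mulrDr [2 * eta / _ * (_ + _)]mulrDr.
  exact: telescope_arith IH (run_step n l0 lL).
(* Boundary terms: the run starts at the uniform policy, of cross entropy log |A|, and at multiplier
   0; the final terms have a favorable sign. *)
have := tele T; rewrite {1}/D (run_theta0 hrun) cross_entropy0 // (run_lambda0 hrun).
have D0 := cross_entropy_ge0 M phi A_gt0 hrho pstar (theta T); rewrite -/(D T) in D0.
have q0 := sqr_ge0 (lambda T - l).
have T0' : 0 < T%:R :> R by rewrite ltr0n.
have e0 : 0 < eta by rewrite invr_gt0 sqrtr_gt0.
have eT : eta ^+ 2 = T%:R^-1 by rewrite exprVn sqr_sqrtr // ltW.
rewrite -/(F _) => tT; rewrite -(ler_pM2l e0) -eT.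
have : T%:R * (eta ^+ 2 * Kc) = Kc.
  by rewrite eT mulrA divff ?mul1r // lt0r_neq0.
move=> TK; rewrite TK in tT.
have : eta * \sum_(t < T) F t <= ln #|A|%:R + l ^+ 2 / 2 + Kc +
    2 * eta / (1 - gamma) * \sum_(t < T) G t.
  by apply: le_trans tT _; rewrite sub0r sqrrN; lra.
(* Multiplying by eta^2 = 1 / T turns the sum into the average. *)
rewrite -(ler_pM2l (exprn_gt0 2 e0)) => H.
apply: le_trans (_ : eta ^+ 2 * (eta * \sum_(t < T) F t) <= _).
  by rewrite mulrCA.
apply: le_trans H _; rewrite le_eqVlt; apply/orP; left; apply/eqP; rewrite /G; ring.
Qed.

(* Mixing the average iterate with the Slater policy restores feasibility. *)
Lemma average_duality : 0 < T%:R^-1 * \sum_(t < T) (b - Vt Utility t) ->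
  - (T%:R^-1 * \sum_(t < T) (b - Vt Utility t)) / (xi * (1 - gamma)) <=
  T%:R^-1 * \sum_(t < T) (Vstar Reward - Vt Reward t).
Proof.
set v := T%:R^-1 * _ => v0.
have T0' : 0 < T%:R :> R by rewrite ltr0n.
have unif : is_dist (fun _ : 'I_T => T%:R^-1 : R).
  split=> [_|]; first by rewrite invr_ge0 ltW.
  by rewrite sumr_const card_ord -[LHS]mulr_natr mulVf // lt0r_neq0.
have [pi1 hpi1 V1] := V_mix M unif (fun t : 'I_T => hpi t) hrho.
have avg (k : R) x : T%:R^-1 * \sum_(t < T) (k - Vt x t) = k - V M pi1 x rho.
  rewrite V1 -big_distrr /= sumrB sumr_const card_ord -[k *+ T]mulr_natl mulrBr.
  by rewrite mulKf // lt0r_neq0.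
case: hslater => _ [pibar [hbar sbar]].
(* The weight for which th xi = (1 - th) v: the slack of the Slater policy exactly offsets the
   average violation. *)
pose th := v / (v + xi).
have vxi : 0 < v + xi by rewrite addr_gt0.
have th0 : 0 <= th by rewrite divr_ge0 // ltW.
have th1 : 0 <= 1 - th.
  by rewrite subr_ge0 ler_pdivrMr // mul1r lerDl ltW.
have wd : is_dist (fun c : bool => if c then th else 1 - th).
  split=> [[]|] //; by rewrite big_bool /= addrC subrK.
have [pi2 hpi2 V2] := V_mix M wd
  (fun c : bool => match c with true => hbar | false => hpi1 end
   : is_policy (if c then pibar else pi1)) hrho.
case: hstar => pstar _ /(_ _ hpi2); rewrite !V2 !big_bool /= avg.
move: (avg b Utility); rewrite -/v => vE.
have V1g : V M pi1 Utility rho = b - v by rewrite vE; ring.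
rewrite V1g.
have thE : th * xi = (1 - th) * v by rewrite /th; field; exact: lt0r_neq0.
have feas : b <= th * V M pibar Utility rho + (1 - th) * (b - v).
  apply: (@le_trans _ _ (th * (b + xi) + (1 - th) * (b - v))).
    by rewrite mulrDr thE; lra.
  by rewrite lerD2r ler_wpM2l //; lra.
move=> /(_ feas) opt.
have r0 := V_ge0 M Reward hbar hrho; have r1 := V_le M Reward pstar hrho.
set Rs := V M pistar Reward rho in opt r1 *.
set R1 := V M pi1 Reward rho in opt *.
(* Optimality against the mixture; the Slater policy has nonnegative reward and the optimal one at
   most 1 / (1 - gamma). *)
have h : (1 - th) * (R1 - Rs) <= th * (1 - gamma)^-1.
  have : th * Rs - th * V M pibar Reward rho <= th * (1 - gamma)^-1.
    by rewrite -mulrBr ler_wpM2l //; lra.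
  by move: opt; lra.
have th1E : 1 - th = xi / (v + xi) by rewrite /th; field; exact: lt0r_neq0.
have : R1 - Rs <= v / (xi * (1 - gamma)).
  have th1' : 0 < 1 - th by rewrite th1E divr_gt0.
  rewrite -(ler_pM2l th1'); apply: le_trans h _.
  rewrite le_eqVlt; apply/orP; left; apply/eqP; rewrite /th.
  by field; rewrite !lt0r_neq0.
by rewrite mulNr; lra.
Qed.

Lemma disc_inv_ge1 : 1 <= (1 - gamma)^-1.
Proof. by rewrite invf_ge1 // gerBl disc_ge0. Qed.

Lemma slater_inv_ge1 : 1 <= (1 - gamma)^-1 * xi^-1.
Proof. by rewrite -invfM invf_ge1 ?mulr_gt0 // mulrC slater_le. Qed.

Lemma ln_card_ge0 : 0 <= ln #|A|%:R :> R.
Proof. by rewrite ln_ge0 // ler1n. Qed.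

Let LambdaE : Lambda = 2 * ((1 - gamma)^-1 * xi^-1).
Proof. by rewrite invfM. Qed.

Let KcE : Kc = (1 - gamma)^-1 ^+ 2 *
  ((W * B) ^+ 2 * (1 + 2 * ((1 - gamma)^-1 * xi^-1)) ^+ 2 + 1) / 2.
Proof.
rewrite /Kc LambdaE; set y := 1 + _.
by field; exact: lt0r_neq0.
Qed.

Lemma run_reward_le :
  T%:R^-1 * \sum_(t < T) (Vstar Reward - Vt Reward t) <=
  (1 + ln #|A|%:R + 5 * B ^+ 2 * W ^+ 2 / xi ^+ 2) / (1 - gamma) ^+ 5 * eta +
  2 / (1 - gamma) *
    (T%:R^-1 * \sum_(t < T) (delta Reward t + Lambda * delta Utility t)).
Proof.
have := run_regret (lexx 0) L0.
under eq_bigr do rewrite mul0r subr0.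
move=> /le_trans; apply; rewrite lerD2r [leRHS]mulrC; apply: ler_wpM2l => //.
rewrite KcE expr0n /= mul0r addr0.
have xi0' : 0 < xi^-1 by rewrite invr_gt0.
have := reward_constant_le disc_inv_ge1 xi0' slater_inv_ge1 ln_card_ge0
  (sqr_ge0 (W * B)).
rewrite !exprVn exprMn; congr (_ <= (_ + _) * _); ring.
Qed.

Lemma run_utility_le :
  positive_part (T%:R^-1 * \sum_(t < T) (b - Vt Utility t)) <=
  ((1 + ln #|A|%:R + B ^+ 2 * W ^+ 2) * xi + (2 + 4 * B ^+ 2 * W ^+ 2) / xi) /
    (1 - gamma) ^+ 4 * eta +
  (1 - gamma) * xi * (2 / (1 - gamma) *
    (T%:R^-1 * \sum_(t < T) (delta Reward t + Lambda * delta Utility t))).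
Proof.
set v := T%:R^-1 * _; set E := 2 / _ * _; set c := _ + _ / xi.
have B0' : 0 <= B ^+ 2 * W ^+ 2 by rewrite mulr_ge0 ?sqr_ge0.
have c0 : 0 <= c.
  have lA := ln_card_ge0.
  by apply: addr_ge0; [apply: mulr_ge0 (ltW xi0)|apply: divr_ge0 (ltW xi0)]; lra.
have E0 : 0 <= E.
  rewrite mulr_ge0 ?divr_ge0 ?(ltW g1) // mulr_ge0 ?invr_ge0 ?ler0n //.
  by apply: sumr_ge0 => t _; rewrite addr_ge0 // mulr_ge0.
have xig : 0 < (1 - gamma) * xi by rewrite mulr_gt0.
have rhs0 : 0 <= c / (1 - gamma) ^+ 4 * eta + (1 - gamma) * xi * E.
  have cg : 0 <= c / (1 - gamma) ^+ 4 by rewrite divr_ge0 // exprn_ge0 // ltW.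
  exact: addr_ge0 (mulr_ge0 cg eta0) (mulr_ge0 (ltW xig) E0).
rewrite /positive_part ge_max rhs0 andbT.
have [v0|v0] := leP v 0; first exact: le_trans rhs0.
have dual := average_duality v0.
have := run_regret L0 (lexx _); rewrite -/E.
have -> : T%:R^-1 * \sum_(t < T)
    (Vstar Reward - Vt Reward t - Lambda * (Vt Utility t - b)) =
    T%:R^-1 * \sum_(t < T) (Vstar Reward - Vt Reward t) + Lambda * v.
  rewrite /v [Lambda * _]mulrCA -mulrDr; congr (_ * _).
  rewrite big_distrr -big_split /=.
  by apply: eq_bigr => t _; rewrite -mulrN opprB.
have xi0' : 0 < xi^-1 by rewrite invr_gt0.
have := utility_constant_le disc_inv_ge1 xi0' slater_inv_ge1 ln_card_ge0
  (sqr_ge0 (W * B)).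
rewrite KcE LambdaE; move: dual; rewrite -/v [xi * _]mulrC invfM.
set ij := (1 - gamma)^-1 / xi; set X := ln _ + _ + _; set avg := T%:R^-1 * _.
have -> : (1 + ln #|A|%:R + (W * B) ^+ 2) * xi^-1^-1 +
    (2 + 4 * (W * B) ^+ 2) / xi = c by rewrite invrK /c; ring.
move=> dual Xc reg.
have ij0 : 0 < ij by rewrite divr_gt0 ?invr_gt0.
(* The regret bound controls [avg] + 2 [ij] [v], and duality gives [avg] >= - [ij] [v]; one multiple
   of [ij] [v] is left. *)
have key : v * ij <= (c / (1 - gamma) ^+ 4 * eta + (1 - gamma) * xi * E) * ij.
  apply: (@le_trans _ _ (eta * X + E)); first by move: dual reg; lra.
  have -> : (c / (1 - gamma) ^+ 4 * eta + (1 - gamma) * xi * E) * ij =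
      eta * (c * (1 - gamma)^-1 ^+ 4 * ij) + E.
    rewrite exprVn mulrDl; congr (_ + _); first by ring.
    by rewrite /ij; field; rewrite !lt0r_neq0.
  by rewrite lerD2r ler_wpM2l.
by rewrite -(ler_pM2r ij0).
Qed.

End PrimalDualRun.

(** * Measurability and expectations *)

Section MeasurableRun.
Context {dO : measure_display} {Omega : measurableType dO} {R : realType}.
Context {S A : finType} (M : cmdp R S A).
Local Notation mfun f := (measurable_fun [set: Omega] f).
Local Notation gamma := (disc M).

(** The finite-time laws are polynomial in the policy and the initial law; the occupancy measure is
    a pointwise limit of their discounted sums. *)
Lemma measurable_occ (pi : Omega -> S -> A -> R) (mu : Omega -> S * A -> R) z :
  (forall omega, is_policy (pi omega)) -> (forall omega, is_dist (mu omega)) ->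
  (forall s a, mfun (fun omega => pi omega s a)) ->
  (forall z, mfun (fun omega => mu omega z)) ->
  mfun (fun omega => occ M (pi omega) (mu omega) z).
Proof.
move=> hpi hmu mpi mmu.
have mlaw t y : mfun (fun omega => law M (pi omega) (mu omega) t y).
  elim: t y => [|t IH] y; first exact: mmu.
  under eq_fun do rewrite lawS.
  apply: measurable_sum => x; apply: measurable_funM; first exact: IH.
  by apply: measurable_funM => //; exact: mpi.
apply: (@measurable_fun_cvg _ _ _ _ (fun n omega =>
  series (fun t => gamma ^+ t * law M (pi omega) (mu omega) t z) n)).
  move=> n; apply: measurable_sum => t.
  exact: measurable_funM.
by move=> omega _; exact: occ_cvg.
Qed.

Context {d : nat} (phi : S * A -> 'cV[R]_d).
Hypothesis A_gt0 : (0 < #|A|)%N.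

Lemma measurable_dotv (v : Omega -> 'cV[R]_d) u :
  random_vector v -> mfun (fun omega => dotv (v omega) u).
Proof.
move=> mv; under eq_fun do rewrite dotvE.
by apply: measurable_sum => i; apply: measurable_funM => //; exact: mv.
Qed.

Lemma measurable_loglinear (theta : Omega -> 'cV[R]_d) s a :
  random_vector theta -> mfun (fun omega => loglinear phi (theta omega) s a).
Proof.
move=> mtheta.
have mexp a' : mfun (fun omega => expR (dotv (theta omega) (phi (s, a')))).
  apply: (@measurableT_comp _ _ _ _ _ _ expR) => //.
  exact: measurable_dotv.
(* The quotient becomes the exponential of a difference, a composition of measurable functions. *)
rewrite (_ : (fun omega => _) = (fun omega => expR (dotv (theta omega) (phi (s, a)) -
    ln (\sum_a' expR (dotv (theta omega) (phi (s, a'))))))); last first.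
  apply/funext => omega.
  by rewrite expRD expRN lnK // posrE softmax_denom_gt0.
apply: (@measurableT_comp _ _ _ _ _ _ expR) => //.
apply: measurable_funB; first exact: measurable_dotv.
apply: (@measurableT_comp _ _ _ _ _ _ (@ln R)); first exact: measurable_ln.
exact: measurable_sum.
Qed.

Context (theta : Omega -> 'cV[R]_d).
Hypothesis mtheta : random_vector theta.

Let hpi omega := loglinear_policy phi A_gt0 (theta omega).

Lemma measurable_return x (mu : Omega -> S * A -> R) :
  (forall omega, is_dist (mu omega)) ->
  (forall z, mfun (fun omega => mu omega z)) ->
  mfun (fun omega => discounted_return M (loglinear phi (theta omega)) x (mu omega)).
Proof.
move=> hmu mmu; under eq_fun do rewrite discounted_returnE //.
apply: measurable_sum => z; apply: measurable_funM => //.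
by apply: measurable_occ => // s a; exact: measurable_loglinear.
Qed.

Lemma measurable_V x rho : is_dist rho ->
  mfun (fun omega => V M (loglinear phi (theta omega)) x rho).
Proof.
move=> hrho; under eq_fun do rewrite V_return //.
apply: measurable_return => [omega|z]; first exact: start_dist.
by apply: measurable_funM => //; exact: measurable_loglinear.
Qed.

Lemma measurable_regr_error x (nu : Omega -> S * A -> R) (v : Omega -> 'cV[R]_d) :
  (forall z, mfun (fun omega => nu omega z)) -> random_vector v ->
  mfun (fun omega => regr_error M phi x (nu omega) (v omega) (theta omega)).
Proof.
move=> mnu mv; apply: measurable_sum => z; apply: measurable_funM => //.
apply: measurable_funX; apply: measurable_funB; last exact: measurable_dotv.
by apply: measurable_return => // omega; exact: start_sa_dist.
Qed.

Lemma measurable_nu_t nu0 z : is_dist nu0 ->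
  mfun (fun omega => nu_t M phi nu0 (theta omega) z).
Proof.
move=> hnu0; rewrite /nu_t; under eq_fun do rewrite visit_saE //.
apply: measurable_funM => //; apply: measurable_occ => // s a.
exact: measurable_loglinear.
Qed.

End MeasurableRun.

(** One joint induction, since each of the two updates reads the other iterate. *)
Lemma measurable_iterates {dO : measure_display} {Omega : measurableType dO}
    {R : realType} {S A : finType} (M : cmdp R S A) {d : nat}
    (phi : S * A -> 'cV[R]_d) (rho : S -> R) (xi W eta1 eta2 : R)
    (w : signal -> nat -> Omega -> 'cV[R]_d)
    (theta : nat -> Omega -> 'cV[R]_d) (lambda : nat -> Omega -> R) :
  (0 < #|A|)%N -> is_dist rho -> 0 < xi ->
  (forall x t, random_vector (w x t)) ->
  (forall omega, npg_pd_run M phi rho xi W eta1 eta2 (fun x t => w x t omega)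
    (fun t => theta t omega) (fun t => lambda t omega)) ->
  forall t, random_vector (theta t) /\ measurable_fun [set: Omega] (lambda t).
Proof.
move=> A0 hrho xi0 mw hrun; elim=> [|t [mtheta mlambda]].
  split=> [i|].
    by under eq_fun do rewrite (run_theta0 (hrun _)) mxE; exact: measurable_cst.
  rewrite (_ : lambda 0%N = fun=> 0); first exact: measurable_cst.
  by apply/funext => omega; exact: run_lambda0 (hrun omega).
split=> [i|].
  under eq_fun do rewrite (run_theta (hrun _)) !mxE.
  apply: measurable_funD; first exact: mtheta.
  apply: measurable_funM => //; apply: measurable_funD; first exact: mw.
  by apply: measurable_funM => //; exact: mw.
have L0 : 0 <= 2 / ((1 - disc M) * xi).
  by rewrite divr_ge0 // mulr_ge0 ?ltW // onem_disc_gt0.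
rewrite (_ : lambda t.+1 = fun omega => Num.min (Num.max
    (lambda t omega - eta2 *
      (V M (loglinear phi (theta t omega)) Utility rho - thr M)) 0)
    (2 / ((1 - disc M) * xi))); last first.
  by apply/funext => omega; apply: is_projection_segment => //; exact: run_lambda (hrun omega) t.
apply: measurable_minr => //; apply: measurable_maxr => //.
apply: measurable_funB => //; apply: measurable_funM => //.
by apply: measurable_funB => //; exact: measurable_V.
Qed.

(** * Expectation bounds for nonnegative random variables *)

Section MeanBound.
Context {dO : measure_display} {Omega : measurableType dO} {R : realType}.
Variable P : probability Omega R.
Implicit Types (X Y : Omega -> R) (a b k : R).

(** Measurability and sign travel with the bound, so that the rules for nonnegative integrals
    compose. *)
Definition mean_le X a : Prop :=
  [/\ measurable_fun [set: Omega] X, forall omega, 0 <= X omega &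
      ('E_P[X] <= a%:E)%E].

Let measurableE X : measurable_fun [set: Omega] X ->
  measurable_fun [set: Omega] (fun omega => (X omega)%:E).
Proof. by move=> mX; apply/measurable_EFinP. Qed.

Lemma mean_leD X Y a b : mean_le X a -> mean_le Y b ->
  mean_le (fun omega => X omega + Y omega) (a + b).
Proof.
move=> [mX X0 Xa] [mY Y0 Yb]; split.
- exact: measurable_funD.
- by move=> omega; exact: addr_ge0.
- move: Xa Yb; rewrite expectation.unlock => Xa Yb.
  under eq_integral do rewrite EFinD.
  rewrite ge0_integralD ?EFinD ?leeD //; try exact: measurableE.
  + by move=> *; rewrite lee_fin.
  + by move=> *; rewrite lee_fin.
Qed.

Lemma mean_leZ X a k : 0 <= k -> mean_le X a ->
  mean_le (fun omega => k * X omega) (k * a).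
Proof.
move=> k0 [mX X0 Xa]; split.
- exact: measurable_funM.
- by move=> omega; exact: mulr_ge0.
- move: Xa; rewrite expectation.unlock => Xa.
  under eq_integral do rewrite EFinM.
  rewrite ge0_integralZl_EFin //; last exact: measurableE.
  + by rewrite EFinM lee_wpmul2l.
  + by move=> *; rewrite lee_fin.
Qed.

Lemma mean_le_cst k : 0 <= k -> mean_le (fun=> k) k.
Proof.
by move=> k0; split=> //; rewrite [leLHS](expectation_cst P k).
Qed.

Lemma mean_le_sum n (X : 'I_n -> Omega -> R) (a : 'I_n -> R) :
  (forall i, mean_le (X i) (a i)) ->
  mean_le (fun omega => \sum_i X i omega) (\sum_i a i).
Proof.
elim: n X a => [|n IH] X a hX.
  under eq_fun do rewrite big_ord0; rewrite big_ord0; exact: mean_le_cst.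
under eq_fun do rewrite big_ord_recl; rewrite big_ord_recl.
by apply: mean_leD => //; exact: IH.
Qed.

(** [X] may change sign, as the average reward gap does; its expectation is bounded by that of its
    positive part, which lies below [Y]. *)
Lemma le_mean_le X Y a : measurable_fun [set: Omega] X ->
  (forall omega, X omega <= Y omega) -> mean_le Y a -> ('E_P[X] <= a%:E)%E.
Proof.
move=> mX XY [mY Y0 Ya]; apply: le_trans Ya.
rewrite expectation.unlock [leLHS]integralE.
apply: (@le_trans _ _ (\int[P]_omega ((fun omega => (X omega)%:E)^\+ omega))%E).
  by apply: geeDl; rewrite oppe_le0; apply: integral_ge0 => omega _; exact: funeneg_ge0.
apply: ge0_le_integral => //.
- exact/measurable_funepos/measurableE.
- exact: measurableE.
- move=> omega _; rewrite funeposE -EFin_max lee_fin ge_max XY; exact: Y0.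
Qed.

Lemma measurable_sqrt : measurable_fun [set: R] (@Num.sqrt R).
Proof. by apply: continuous_measurable_fun; exact: sqrt_continuous. Qed.

(* Jensen: [sqrt x <= (x / c + c) / 2] for every [c > 0]; let [c] decrease to
   [sqrt a]. *)
Lemma mean_le_sqrt X a : mean_le X a ->
  mean_le (fun omega => Num.sqrt (X omega)) (Num.sqrt a).
Proof.
move=> hX; case: (hX) => mX X0 Xa.
have msqrt : measurable_fun [set: Omega] (fun omega => Num.sqrt (X omega)).
  by apply: (@measurableT_comp _ _ _ _ _ _ (@Num.sqrt R)) => //; exact: measurable_sqrt.
split=> [//|omega|]; first exact: sqrtr_ge0.
have a0 : 0 <= a.
  rewrite -lee_fin; apply: le_trans Xa; rewrite expectation.unlock.
  by apply: integral_ge0 => omega _; rewrite lee_fin.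
(* The margin [e] keeps c = sqrt a + e positive even when a = 0. *)
apply/lee_addgt0Pr => e e0; rewrite -EFinD.
have s0 := sqrtr_ge0 a; set c := Num.sqrt a + e.
have c0 : 0 < c by rewrite ltr_wpDl.
have k0 : 0 <= (2 * c)^-1 by rewrite invr_ge0 mulr_ge0 // ltW.
have c20 : 0 <= c / 2 by rewrite divr_ge0 // ltW.
apply: (@le_trans _ _ ((2 * c)^-1 * a + c / 2)%:E); last first.
  rewrite lee_fin -[X in _ * X + _](sqr_sqrtr a0).
  have -> : (2 * c)^-1 * Num.sqrt a ^+ 2 = Num.sqrt a ^+ 2 / (2 * c) by rewrite mulrC.
  have : Num.sqrt a ^+ 2 / (2 * c) <= c / 2.
    by rewrite ler_pdivrMr ?mulr_gt0 // /c; nra.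
  by rewrite /c; lra.
apply: le_mean_le (mean_leD (mean_leZ k0 hX) (mean_le_cst c20)) => // omega.
have sx := sqrtr_ge0 (X omega); rewrite -{2}(sqr_sqrtr (X0 omega)).
have -> : (2 * c)^-1 * Num.sqrt (X omega) ^+ 2 + c / 2 =
  (Num.sqrt (X omega) ^+ 2 + c ^+ 2) / (2 * c) by field; exact: lt0r_neq0.
rewrite ler_pdivlMr ?mulr_gt0 //.
by have := sqr_ge0 (Num.sqrt (X omega) - c); lra.
Qed.

End MeanBound.

Theorem theorem13
  (R : realType) (S A : finType) (M : cmdp R S A)
  (rho : S -> R) (hrho : is_dist rho)
  (nu0 : S * A -> R) (hnu0 : is_dist nu0)
  (xi : R) (hslater : slater M rho xi)
  (pistar : S -> A -> R) (hpistar : is_optimal M rho pistar)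
  (d : nat) (phi : S * A -> 'cV[R]_d)
  (B : R) (hphi : forall z, norm2 (phi z) <= B)
  (W : R) (hW : 0 < W)
  (T : nat) (hT : (0 < T)%N)
  (dO : measure_display) (Omega : measurableType dO) (P : probability Omega R)
  (w : signal -> nat -> Omega -> 'cV[R]_d)
  (theta : nat -> Omega -> 'cV[R]_d) (lambda : nat -> Omega -> R)
  (hw : forall x t, random_vector (w x t))
  (hrun : forall omega,
    npg_pd_run M phi rho xi W (Num.sqrt T%:R)^-1 (Num.sqrt T%:R)^-1
      (fun x t => w x t omega) (fun t => theta t omega)
      (fun t => lambda t omega))
  (wstar : signal -> nat -> Omega -> 'cV[R]_d)
  (hwstar : forall x t, random_vector (wstar x t))
  (hargmin : forall x t omega,
    is_regr_argmin M phi W x (nu_t M phi nu0 (theta t omega))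
      (theta t omega) (wstar x t omega))
  (eps_est eps_bias : R)
  (hest : forall x t,
    ('E_P[fun omega =>
        (regr_error M phi x (nu_t M phi nu0 (theta t omega))
          (w x t omega) (theta t omega)
        - regr_error M phi x (nu_t M phi nu0 (theta t omega))
          (wstar x t omega) (theta t omega))%R] <= eps_est%:E)%E)
  (hbias : forall x t,
    ('E_P[fun omega =>
        regr_error M phi x (nu_star M rho pistar)
          (wstar x t omega) (theta t omega)] <= eps_bias%:E)%E)
  (hkappa : (rel_cond_number phi (nu_star M rho pistar) nu0 < +oo)%E) :
  let gamma := disc M in
  let b := thr M in
  let cardA : R := #|A|%:R in
  let kappa : R := fine (rel_cond_number phi (nu_star M rho pistar) nu0) in
  let C3 := 1 + ln cardA + 5 * B ^+ 2 * W ^+ 2 / xi ^+ 2 in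
  let C4 := (1 + ln cardA + B ^+ 2 * W ^+ 2) * xi
            + (2 + 4 * B ^+ 2 * W ^+ 2) / xi in
  let err := Num.sqrt (cardA * eps_bias)
             + Num.sqrt (kappa * cardA * eps_est / (1 - gamma)) in
  let Vt x t omega := V M (loglinear phi (theta t omega)) x rho in
  ('E_P[fun omega =>
      (T%:R^-1 * \sum_(t < T) (V M pistar Reward rho - Vt Reward t omega))%R]
   <= (C3 / (1 - gamma) ^+ 5 * (Num.sqrt T%:R)^-1
       + (2 + 4 / xi) / (1 - gamma) ^+ 2 * err)%R%:E)%E
  /\
  ('E_P[fun omega =>
      positive_part (T%:R^-1 * \sum_(t < T) (b - Vt Utility t omega))%R]
   <= (C4 / (1 - gamma) ^+ 4 * (Num.sqrt T%:R)^-1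
       + (4 + 2 * xi) / (1 - gamma) * err)%R%:E)%E.
Proof.
move=> gamma b cardA kappa C3 C4 err Vt.
have g1 : 0 < 1 - gamma := onem_disc_gt0 M.
have xi0 : 0 < xi by case: hslater.
have [pstar _ _] := hpistar.
(* [rho] has mass one, so a state exists, and [pistar] has mass one over the actions there. *)
have A_gt0 : (0 < #|A|)%N.
  have [s _|S0] := pickP (fun _ : S => true); last first.
    by move: (hrho.2); rewrite big_pred0 // => /esym/eqP; rewrite oner_eq0.
  rewrite lt0n; apply/eqP => A0.
  by move: (pstar s).2; rewrite big_pred0 ?(eq_card0 A0) // => [/esym/eqP|a];
    [rewrite oner_eq0|exact: (card0_eq A0)].
have cardA0 : 0 <= cardA by exact: ler0n.
have kappa0 : 0 <= kappa by rewrite fine_ge0 // rel_cond_number_ge0.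
set Lambda := 2 / ((1 - gamma) * xi).
have L0 : 0 <= Lambda by rewrite divr_ge0 // mulr_ge0 // ltW.
have mrun t : random_vector (theta t) by
  have [] := measurable_iterates A_gt0 hrho xi0 hw hrun t.
have mV x t : measurable_fun [set: Omega] (Vt x t) by exact: measurable_V.
pose delta x t omega := approx_error M phi rho pistar kappa
  (nu_t M phi nu0 (theta t omega)) x (theta t omega) (w x t omega) (wstar x t omega).
have delta_ge0 x t omega : 0 <= delta x t omega by rewrite addr_ge0 // sqrtr_ge0.
have hdelta x t omega := regression_gap_le A_gt0 hrho pstar hnu0 hkappa
  (hargmin x t omega) (run_w (hrun omega) x t).
(* Jensen under each root; the excess regression error is nonnegative because [wstar] is a minimizer
   and [w] lies in the ball. *)
have mean_delta x t : mean_le P (delta x t) err.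
  apply: mean_leD; first apply: mean_le_sqrt; first apply: mean_leZ => //.
    split; [|move=> omega|exact: hbias].
      exact: measurable_regr_error.
    by apply: regr_error_ge0 => z; exact: nu_star_ge0.
  have -> : kappa * cardA * eps_est / (1 - gamma) =
    kappa * cardA / (1 - gamma) * eps_est by rewrite mulrAC.
  apply: mean_le_sqrt; apply: mean_leZ.
    by rewrite divr_ge0 ?mulr_ge0 // ltW.
  split; [|move=> omega|exact: hest].
    by apply: measurable_funB; apply: measurable_regr_error => // z;
      exact: measurable_nu_t.
  rewrite subr_ge0; apply: (hargmin x t omega).2; exact: run_w (hrun omega) x t.
have err0 : 0 <= err by rewrite addr_ge0 ?sqrtr_ge0.
pose total omega := 2 / (1 - gamma) * (T%:R^-1 *
  \sum_(t < T) (delta Reward t omega + Lambda * delta Utility t omega)).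
have mean_total : mean_le P total (2 / (1 - gamma) * ((1 + Lambda) * err)).
  have -> : (1 + Lambda) * err = T%:R^-1 * \sum_(t < T) (err + Lambda * err).
    rewrite sumr_const card_ord -[(err + _) *+ T]mulr_natl mulKf ?mulrDl ?mul1r //.
    by rewrite pnatr_eq0 -lt0n.
  apply: mean_leZ; first by rewrite divr_ge0 // ltW.
  apply: mean_leZ; first by rewrite invr_ge0 ler0n.
  by apply: mean_le_sum => t; apply: mean_leD => //; exact: mean_leZ.
have lA : 0 <= ln cardA by rewrite ln_ge0 // ler1n.
have eta0 : 0 <= (Num.sqrt T%:R)^-1 :> R by rewrite invr_ge0 sqrtr_ge0.
have BW0 : 0 <= B ^+ 2 * W ^+ 2 by rewrite mulr_ge0 ?sqr_ge0.
have i1 : 1 <= (1 - gamma)^-1 := disc_inv_ge1 M.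
split.
- have c0 : 0 <= C3 / (1 - gamma) ^+ 5 * (Num.sqrt T%:R)^-1.
    rewrite mulr_ge0 // divr_ge0 ?exprn_ge0 ?(ltW g1) //.
    rewrite addr_ge0 ?divr_ge0 ?sqr_ge0 //; last by rewrite -mulrA mulr_ge0.
    by rewrite addr_ge0.
  apply: le_trans (le_mean_le _ _ (mean_leD (mean_le_cst P c0) mean_total)) _.
  + apply: measurable_funM => //; apply: measurable_sum => t.
    exact: measurable_funB.
  + move=> omega; exact: (run_reward_le A_gt0 hrho hslater hpistar hphi (ltW hW) hT
      (hrun omega) (fun x t => delta_ge0 x t omega) (fun x t => hdelta x t omega)).
  (* With i = 1 / (1 - gamma) and j = 1 / xi this is 2 i + 4 i^2 j <= (2 + 4 j) i^2, from i >= 1. *)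
  + rewrite lee_fin lerD2l mulrA ler_wpM2r //.
    rewrite /Lambda invfM expr2 invfM.
    move: i1; set i := (1 - gamma)^-1 => i1.
    have j0 : 0 < xi^-1 by rewrite invr_gt0.
    have : 0 <= i * (i - 1) by rewrite mulr_ge0 ?subr_ge0 // (le_trans ler01).
    by move: (xi^-1) j0 => j j0; nra.
- have c0 : 0 <= C4 / (1 - gamma) ^+ 4 * (Num.sqrt T%:R)^-1.
    rewrite mulr_ge0 // divr_ge0 ?exprn_ge0 ?(ltW g1) //.
    by apply: addr_ge0; [apply: mulr_ge0 (ltW xi0)|apply: divr_ge0 (ltW xi0)]; lra.
  have k0 : 0 <= (1 - gamma) * xi by rewrite mulr_ge0 ?ltW.
  apply: le_trans (le_mean_le _ _
    (mean_leD (mean_le_cst P c0) (mean_leZ k0 mean_total))) _.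
  + apply: measurable_maxr => //; apply: measurable_funM => //.
    by apply: measurable_sum => t; exact: measurable_funB.
  + move=> omega; exact: (run_utility_le A_gt0 hrho hslater hpistar hphi (ltW hW) hT
      (hrun omega) (fun x t => delta_ge0 x t omega) (fun x t => hdelta x t omega)).
  (* The factor becomes 2 xi + 4 i, at most (4 + 2 xi) i since i >= 1. *)
  + rewrite lee_fin lerD2l !mulrA ler_wpM2r //.
    have -> : (1 - gamma) * xi * 2 / (1 - gamma) * (1 + Lambda) =
        2 * xi + 4 * (1 - gamma)^-1.
      by rewrite /Lambda; field; rewrite !lt0r_neq0.
    move: i1; set i := (1 - gamma)^-1 => i1.
    have : 0 <= xi * (i - 1) by rewrite mulr_ge0 ?subr_ge0 // ltW.
    by lra.
Qed.
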